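(* If $x\in L(s',s)\subset K(l_2)$ is normal, then for every function $f\colon\sigma(x)\to\mathbb C$ which is Hölder continuous at zero and satisfies $f(0)=0$, the operator $f(x)$ belongs to $L(s',s)$ as well. In particular, for every normal operator $x\in L(s',s)$ with $\sigma(x)\subset[0,\infty)$ and every $\theta\in(0,\infty)$, $x^\theta\in L(s',s)$.
   Context: $\mathbb N=\{1,2,\dots\}$, $\mathbb N_0=\mathbb N\cup\{0\}$. $s$ is the Fréchet space of complex sequences $\xi=(\xi_j)_{j\in\mathbb N}$ with $|\xi|_q:=(\sum_{j}|\xi_j|^2j^{2q})^{1/2}<\infty$ for all $q\in\mathbb N_0$, with the topology of the norms $(|\cdot|_q)_{q\in\mathbb N_0}$. $s'$ is the space of complex sequences with $|\xi|'_q:=(\sum_j|\xi_j|^2j^{-2q})^{1/2}<\infty$ for some $q\in\mathbb N_0$, with the inductive limit topology. Note $s\subset l_2\subset s'$ continuously. $L(s',s)$ is the space of continuous linear operators $x:s'\to s$. Restriction to $l_2$ embeds it into the compact operators $K(l_2)$; via this embedding $L(s',s)$ is regarded as a subalgebra of $K(l_2)$ closed under the Hilbert space adjoint. An operator on $l_2$ ''belongs to $L(s',s)$'' if it is the restriction of an element of $L(s',s)$. $\sigma(x)$ is the spectrum of $x$ in $L(l_2)$ (equivalently in $L(s',s)$): zero together with the eigenvalues of $x$. A function $f\colon X\to\mathbb C$ ($0\in X\subset\mathbb C$) is Hölder continuous at zero if there are $\theta\in(0,1]$ and $C>0$ such that $|f(t)-f(0)|\le C|t|^\theta$ for all $t\in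 X$ in a neighborhood of $0$. $f(x)\in K(l_2)$ is given by the continuous functional calculus for normal operators on $l_2$: if $x=\sum_n\lambda_nP_n$ is the spectral representation of $x$, then $f(x)=\sum_nf(\lambda_n)P_n$; $x^\theta$ is $f(x)$ for $f(t)=t^\theta$. *)

(* Defs.v *)
From HB Require Import structures.
From mathcomp Require Import all_boot all_order all_algebra.
From mathcomp Require Import all_classical all_reals all_analysis.
From mathcomp Require Import complex ring.

Set Implicit Arguments.
Unset Strict Implicit.
Unset Printing Implicit Defensive.

Import Order.TTheory GRing.Theory Num.Theory.
Import numFieldNormedType.Exports.

Local Open Scope classical_set_scope.
Local Open Scope ring_scope.
Local Open Scope complex_scope.

Import Normc.

Section Sequences.
Variable R : realType.

(* A sequence (xi_j)_{j >= 1} is indexed from 0, so that [xi j] stands for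
   xi_{j+1} and carries the weight j+1.  R[i]^o is R[i] with its module
   structure over itself and its normed topology. *)
Definition cseq := nat -> R[i]^o.

Definition wsum (q : int) (xi : cseq) : \bar R :=
  (\sum_(0 <= j <oo) (normc (xi j) ^+ 2 * j.+1%:R ^ (q * 2))%:E)%E.

(* [wnorm q] is |.|_q for q >= 0 and [wnorm (- q)] is |.|'_q; q = 0 gives the
   norm of l_2.  The value is +oo when the series diverges. *)
Definition wnorm (q : int) (xi : cseq) : \bar R := (wsum q xi `^ 2^-1)%E.

Arguments wsum q%_R xi%_R.
Arguments wnorm q%_R xi%_R.

Definition in_l2 : pred cseq := fun xi => `[< (wnorm 0 xi < +oo)%E >].

Definition in_s : pred cseq :=
  fun xi => `[< forall q : nat, (wnorm q%:Z xi < +oo)%E >].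

Definition in_s' : pred cseq :=
  fun xi => `[< exists q : nat, (wnorm (- q%:Z) xi < +oo)%E >].

Lemma wterm_ge0 q (xi : cseq) j :
  (0 <= (normc (xi j) ^+ 2 * j.+1%:R ^ (q * 2))%:E :> \bar R)%E.
Proof.
by rewrite lee_fin mulr_ge0 ?sqr_ge0// exprz_ge0.
Qed.

Lemma wsum_ge0 q xi : (0 <= wsum q xi)%E.
Proof. by apply: nneseries_ge0 => j _ _; exact: wterm_ge0. Qed.

Lemma wnorm_lty q xi : (wnorm q xi < +oo)%E = (wsum q xi < +oo)%E.
Proof.
rewrite /wnorm; have := wsum_ge0 q xi; case: (wsum q xi) => [r| |] //= _.
- by rewrite !ltry.
- by rewrite invr_eq0 pnatr_eq0/= ltxx.
Qed.

Lemma wnorm0 q : wnorm q (0 : cseq) = 0%E.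
Proof.
rewrite /wnorm; have -> : wsum q 0 = 0%E.
  by apply: eseries0 => j _ _; rewrite [normc _]normc0 expr0n/= mul0r.
by rewrite poweR0r// invr_eq0 pnatr_eq0.
Qed.

Lemma normc_sq_lin (a u v : R[i]) :
  normc (a * u + v) ^+ 2 <=
  2 * normc a ^+ 2 * normc u ^+ 2 + 2 * normc v ^+ 2.
Proof.
have n0 (z : R[i]) : 0 <= normc z by case: z => *; exact: sqrtr_ge0.
apply: (@le_trans _ _ ((normc a * normc u + normc v) ^+ 2)).
  rewrite ler_sqr ?nnegrE ?addr_ge0 ?mulr_ge0//.
  by rewrite -normcM le_normcD.
rewrite -mulrA -exprMn; set A := normc a * normc u; set B := normc v.
rewrite -subr_ge0 (_ : _ - _ = (A - B) ^+ 2) ?sqr_ge0//.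
by rewrite sqrrB sqrrD; ring.
Qed.

Lemma wnorm_lin_lty q (a : R[i]) (u v : cseq) :
  (wnorm q u < +oo)%E -> (wnorm q v < +oo)%E ->
  (wnorm q (a *: u + v) < +oo)%E.
Proof.
rewrite !wnorm_lty => hu hv.
apply: (@le_lt_trans _ _
  ((2 * normc a ^+ 2)%:E * wsum q u + 2%:E * wsum q v)%E).
  have t0 w j : true ->
      (0 <= (normc (w j : R[i]) ^+ 2 * j.+1%:R ^ (q * 2))%:E :> \bar R)%E.
    by move=> _; exact: wterm_ge0.
  rewrite /wsum -(nneseriesZl _ _ (t0 u)) -(nneseriesZl _ _ (t0 v)).
  rewrite -nneseriesD => [|j _ _|j _ _]; last 2 first.
  - by rewrite mule_ge0 ?wterm_ge0// lee_fin mulr_ge0 ?sqr_ge0.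
  - by rewrite mule_ge0 ?wterm_ge0// lee_fin.
  apply: lee_nneseries => [j _ _|j _]; first exact: wterm_ge0.
  rewrite -!EFinM -EFinD lee_fin.
  apply: le_trans (ler_wpM2r _ (normc_sq_lin a (u j) (v j))) _.
    by rewrite exprz_ge0.
  by rewrite mulrDl !mulrA.
apply: lte_add_pinfty; apply: lte_mul_pinfty => //.
by rewrite lee_fin mulr_ge0 ?sqr_ge0.
Qed.

Lemma wnorm_le_lty (p q : int) xi :
  p <= q -> (wnorm q xi < +oo -> wnorm p xi < +oo)%E.
Proof.
move=> pq; rewrite !wnorm_lty; apply: le_lt_trans.
apply: lee_nneseries => [j _ _|j _]; first exact: wterm_ge0.
rewrite lee_fin ler_wpM2l ?sqr_ge0//.
by apply: ler_weXz2l; rewrite ?ler1n ?ler_pM2r.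
Qed.

Lemma in_l2_submod : submod_closed in_l2.
Proof.
split=> [|a u v]; first by apply/asboolP; rewrite wnorm0.
by move=> /asboolP hu /asboolP hv; apply/asboolP; exact: wnorm_lin_lty.
Qed.

Lemma in_s_submod : submod_closed in_s.
Proof.
split=> [|a u v].
  by apply/asboolP => q; rewrite wnorm0.
by move=> /asboolP hu /asboolP hv; apply/asboolP => q; exact: wnorm_lin_lty.
Qed.

Lemma in_s'_submod : submod_closed in_s'.
Proof.
split=> [|a u v].
  by apply/asboolP; exists 0; rewrite wnorm0.
move=> /asboolP[p hu] /asboolP[q hv]; apply/asboolP; exists (maxn p q).
apply: wnorm_lin_lty; [apply: wnorm_le_lty hu|apply: wnorm_le_lty hv];
  rewrite lerN2 lez_nat ?leq_maxl ?leq_maxr//.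
Qed.

HB.instance Definition _ :=
  GRing.isSubmodClosed.Build R[i] cseq in_l2 in_l2_submod.
HB.instance Definition _ :=
  GRing.isSubmodClosed.Build R[i] cseq in_s in_s_submod.
HB.instance Definition _ :=
  GRing.isSubmodClosed.Build R[i] cseq in_s' in_s'_submod.

Record l2 := L2 { l2_val :> cseq; l2P : in_l2 l2_val }.
Record s := S_ { s_val :> cseq; sP : in_s s_val }.
Record s' := S'_ { s'_val :> cseq; s'P : in_s' s'_val }.

HB.instance Definition _ := [isSub for l2_val].
HB.instance Definition _ := [Choice of l2 by <:].
HB.instance Definition _ := [SubChoice_isSubLmodule of l2 by <:].

HB.instance Definition _ := [isSub for s_val].
HB.instance Definition _ := [Choice of s by <:].
HB.instance Definition _ := [SubChoice_isSubLmodule of s by <:].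

HB.instance Definition _ := [isSub for s'_val].
HB.instance Definition _ := [Choice of s' by <:].
HB.instance Definition _ := [SubChoice_isSubLmodule of s' by <:].

Lemma in_l2_in_s' (xi : l2) : in_s' xi.
Proof. by apply/asboolP; exists 0%N; rewrite oppr0; apply/asboolP/l2P. Qed.

Definition l2_s' (xi : l2) : s' := S'_ (in_l2_in_s' xi).

(* The topology of s is generated by the norms |.|_q, q >= 0. *)
Definition s_open (U : set s) : Prop :=
  forall x, U x -> exists (q : nat) (e : R), 0 < e /\
    forall y : s,
      (forall k : nat, (k <= q)%N -> (wnorm k%:Z (y - x) < e%:E)%E) -> U y.

Lemma s_openT : s_open setT.
Proof. by move=> x _; exists 0%N, 1. Qed.

Lemma s_openI : setI_closed s_open.
Proof.
move=> U V oU oV x [/oU[p [e [e0 hU]]] /oV[q [d [d0 hV]]]].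
exists (maxn p q), (Num.min e d); split=> [|y hy]; first by rewrite lt_min e0.
split; [apply: hU|apply: hV] => k kq.
- apply: (lt_le_trans (hy k _)); first by rewrite leq_max kq.
  by rewrite lee_fin ge_min lexx.
- apply: (lt_le_trans (hy k _)); first by rewrite leq_max kq orbT.
  by rewrite lee_fin ge_min lexx orbT.
Qed.

Lemma s_open_bigU (I : Type) (f : I -> set s) :
  (forall i, s_open (f i)) -> s_open (\bigcup_i f i).
Proof.
move=> of_ x [i _ /of_[q [e [e0 h]]]]; exists q, e; split=> // y /h fy.
by exists i.
Qed.

HB.instance Definition _ := isOpenTopological.Build s
  s_openT s_openI s_open_bigU.

(* s' is the locally convex inductive limit of the Hilbert spaces
   {xi | |xi|'_q < oo}: a basis of neighbourhoods of 0 consists of the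
   absolutely convex sets meeting each step in a neighbourhood of 0. *)
Definition abs_convex (V : set s') : Prop :=
  forall (u v : s') (a b : R[i]),
    V u -> V v -> `|a| + `|b| <= 1 -> V (a *: u + b *: v).

Definition s'_basic_nbhs0 (V : set s') : Prop :=
  abs_convex V /\
  forall q : nat, exists e : R, 0 < e /\
    forall u : s', (wnorm (- q%:Z) u < e%:E)%E -> V u.

Definition s'_open (U : set s') : Prop :=
  forall x, U x -> exists V, s'_basic_nbhs0 V /\ forall v, V v -> U (x + v).

Lemma s'_openT : s'_open setT.
Proof.
by move=> x _; exists setT; do 2!split=> //; move=> q; exists 1.
Qed.

Lemma s'_openI : setI_closed s'_open.
Proof.
move=> U V oU oV x [/oU[A [[cA nA] hA]] /oV[B [[cB nB] hB]]].
exists (A `&` B); split; last by move=> v [/hA ? /hB ?].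
split=> [u v a b [Au Bu] [Av Bv] ab|q]; first by split; [exact: cA|exact: cB].
have [e [e0 he]] := nA q; have [d [d0 hd]] := nB q.
exists (Num.min e d); split=> [|u hu]; first by rewrite lt_min e0.
split; [apply: he|apply: hd]; apply: (lt_le_trans hu).
- by rewrite lee_fin ge_min lexx.
- by rewrite lee_fin ge_min lexx orbT.
Qed.

Lemma s'_open_bigU (I : Type) (f : I -> set s') :
  (forall i, s'_open (f i)) -> s'_open (\bigcup_i f i).
Proof.
move=> of_ x [i _ /of_[V [nV h]]]; exists V; split=> // v /h fv.
by exists i.
Qed.

HB.instance Definition _ := isOpenTopological.Build s'
  s'_openT s'_openI s'_open_bigU.

(* x is the restriction to l_2 of a continuous linear operator s' -> s. *)
Definition in_Ls's (x : l2 -> l2) : Prop :=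
  exists T : {linear s' -> s},
    continuous T /\ forall xi : l2, T (l2_s' xi) = x xi :> cseq.

Definition inner (xi eta : l2) : R[i] :=
  lim (series (fun j => l2_val xi j * (l2_val eta j)^*%C : R[i]^o) @ \oo).

Definition adjoint_to (x y : l2 -> l2) : Prop :=
  forall xi eta, inner (x xi) eta = inner xi (y eta).

Definition normal_op (x : l2 -> l2) : Prop :=
  exists y : {linear l2 -> l2}, adjoint_to x y /\ x \o y = y \o x.

Definition bounded_op (x : l2 -> l2) : Prop :=
  exists M : R, forall xi, (wnorm 0 (x xi) <= M%:E * wnorm 0 xi)%E.

Definition spectrum (x : l2 -> l2) : set R[i] :=
  [set lam | ~ exists y : {linear l2 -> l2}, bounded_op y /\
     let xlam := fun xi => x xi - lam *: xi in
     cancel xlam y /\ cancel y xlam].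

Definition eigenspace (x : l2 -> l2) (lam : R[i]) : set l2 :=
  [set xi | x xi = lam *: xi].

Definition eigenvalues (x : l2 -> l2) : set R[i] :=
  [set lam | exists xi, xi != 0 /\ eigenspace x lam xi].

Definition is_orthoproj (E : set l2) (P : l2 -> l2) : Prop :=
  forall xi, E (P xi) /\ forall eta, E eta -> inner (xi - P xi) eta = 0.

(* Convergence in the operator norm of L(l_2). *)
Definition op_cvg (u : nat -> l2 -> l2) (y : l2 -> l2) : Prop :=
  forall e : R, 0 < e -> \forall n \near \oo,
    forall xi, (wnorm 0 (u n xi - y xi) <= e%:E * wnorm 0 xi)%E.

(* y = sum over n in I of mu_n P_n; the index set I may be finite. *)
Definition op_sum (I : set nat) (mu : nat -> R[i])
    (P : nat -> l2 -> l2) (y : l2 -> l2) : Prop :=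
  op_cvg (fun n xi => \sum_(k < n | (k : nat) \in I) mu k *: P k xi) y.

Definition spectral_representation (x : l2 -> l2) (I : set nat)
    (lam : nat -> R[i]) (P : nat -> l2 -> l2) : Prop :=
  [/\ set_inj I lam,
      lam @` I = eigenvalues x `\ 0,
      forall n, I n -> is_orthoproj (eigenspace x (lam n)) (P n)
    & op_sum I lam P x].

(* y = f(x) for f vanishing at 0: the eigenvalue 0 contributes nothing. *)
Definition is_fun_calc (f : R[i] -> R[i]) (x y : l2 -> l2) : Prop :=
  exists I lam P, spectral_representation x I lam P /\
    op_sum I (f \o lam) P y.

Definition holder_at0 (X : set R[i]) (f : R[i] -> R[i]) : Prop :=
  exists theta C : R, [/\ 0 < theta <= 1, 0 < C &
    \forall t \near (0 : R[i]^o),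
      X t -> normc (f t - f 0) <= C * normc t `^ theta].

(* t |-> t^theta on [0, oo); the values off [0, oo) are irrelevant. *)
Definition cpower (theta : R) (t : R[i]) : R[i] :=
  (complex.Re t `^ theta)%:C.

End Sequences.

(* Main.v *)
(* By continuity from s' to s, b_j = |x e_j| decreases rapidly (e_j the unit
   vectors); in particular x is Hilbert-Schmidt.  The spectral theorem for x is
   obtained by maximizing |<x u, u>| over the unit ball of the orthogonal complement
   of the known eigenvectors: a maximizer exists by weak compactness and, x being
   normal, is an eigenvector.  Let P_k be the projection onto the eigenspace of
   lambda_k.  Bessel's inequality for e_j and for x e_j gives
     sum_k |P_k e_j|^2 <= 1  and  sum_k |lambda_k|^2 |P_k e_j|^2 <= b_j^2,
   hence sum_k |lambda_k|^t |P_k e_j|^2 <= 2 b_j^t for 0 < t <= 2.  So if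
   |mu_k| <= c |lambda_k|^t, the matrix of sum_k mu_k P_k is bounded entrywise by
   2 c (b_i b_j)^(t/2), which decreases rapidly in both indices, and such matrices
   define operators from s' to s.  With t = theta / 2 the tails of the sum have
   arbitrarily small c, whence convergence in operator norm. *)
From HB Require Import structures.
Require Import Defs.
From mathcomp Require Import all_boot all_order all_algebra.
From mathcomp Require Import all_classical all_reals all_analysis.
From mathcomp Require Import complex ring lra.

Import Order.TTheory GRing.Theory Num.Theory.
Import numFieldNormedType.Exports.
Local Open Scope classical_set_scope.
Local Open Scope ring_scope.

Set Implicit Arguments.
Unset Strict Implicit.
Unset Printing Implicit Defensive.
Import Normc.
Local Open Scope complex_scope.

(** * Absolutely convergent complex series *)

Section Complex.
Variable R : realType.
Local Notation C := R[i].
Implicit Types (z w : C) (u v : nat -> C).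

(** [is_fun_calc] asserts that a spectral representation exists, so the spectral series must be
    shown to converge to [x] in operator norm. The construction of [sum_k mu_k P_k] serves for this
    too: it is applied with [mu = lam], and the operator obtained is then identified with [x]. The
    coordinates of [xs u], not those of [x u], are pairings of [u] with the columns [x e_j];
    normality, as [|xs u| = |x u|], carries the estimates over to [x]. The projections are bare
    functions characterized by orthogonality and are handled by moving them across inner products.
    The exponent is halved because |lambda_k|^theta is a product of two factors
    |lambda_k|^(theta/2): one gives the decay of the matrix entries, the other tends to 0 and gives
    convergence. Cauchy-Schwarz over k halves it once more, which is the t/2 on b_i and b_j. *)

Lemma normc_ge0 z : 0 <= normc z.
Proof. by case: z => a b; exact: sqrtr_ge0. Qed.

Lemma normc_sqE z : normc z ^+ 2 = complex.Re z ^+ 2 + complex.Im z ^+ 2.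
Proof. by case: z => a b /=; rewrite sqr_sqrtr// addr_ge0// sqr_ge0. Qed.

Lemma normc_conj z : normc z^*%C = normc z.
Proof. by case: z => a b /=; rewrite sqrrN. Qed.

Lemma normrcE z : `|z| = (normc z)%:C.
Proof. by case: z. Qed.

Lemma mul_conjc z : z * z^*%C = (normc z ^+ 2)%:C.
Proof. by rewrite rmorphXn /= -normrcE sqr_normc. Qed.

Lemma normc_real (a : R) : normc a%:C = `|a|.
Proof. by rewrite /= expr0n addr0 sqrtr_sqr. Qed.

Lemma normc_sum (I : Type) (r : seq I) (Q : pred I) (F : I -> C) :
  normc (\sum_(i <- r | Q i) F i) <= \sum_(i <- r | Q i) normc (F i).
Proof.
apply: (big_ind2 (fun z a => normc z <= a)) => //; first by rewrite normc0.
by move=> z a w b za wb; apply: le_trans (le_normcD _ _) (lerD za wb).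
Qed.

Lemma normcB z w : normc (z - w) = normc (w - z).
Proof. by rewrite -normcN opprB. Qed.

Lemma normc_Re z : `|complex.Re z| <= normc z.
Proof. by have := normc_ge_Re z; rewrite normrcE lecR. Qed.

Lemma normc_Im z : `|complex.Im z| <= normc z.
Proof.
rewrite -(ler_pXn2r (n := 2)) ?nnegrE ?normc_ge0//.
by rewrite normc_sqE real_normK ?num_real// lerDr sqr_ge0.
Qed.

Lemma normc_le_ReIm z : normc z <= `|complex.Re z| + `|complex.Im z|.
Proof.
rewrite -(ler_pXn2r (n := 2)) ?nnegrE ?normc_ge0 ?addr_ge0//.
rewrite normc_sqE sqrrD !real_normK ?num_real// -addrA lerD2l lerDr.
by rewrite mulrn_wge0// mulr_ge0.
Qed.

Lemma cvgcP (u : nat -> C) (l : C) :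
  ((u : nat -> C^o) @ \oo --> (l : C^o)) <->
  (forall e : R, 0 < e -> \forall n \near \oo, normc (l - u n) < e).
Proof.
split=> [/cvgrPdist_lt h e e0|h].
  have /h : (0 : C) < e%:C by rewrite ltcR.
  by apply: filterS => n; rewrite normrcE ltcR.
apply/cvgrPdist_lt => -[e e'] /[!ltcE]/= /andP[/eqP -> e0].
by apply: filterS (h e e0) => n nl; rewrite normrcE ltcR.
Qed.

Definition abs_summable u :=
  exists M : R, forall n, \sum_(j < n) normc (u j) <= M.

Definition csum u : C := lim ((series u : nat -> C^o) @ \oo).

(** [Re] and [Im] are dominated by [normc], so each gives an absolutely convergent real series. *)
Lemma csum_cvg u : abs_summable u ->
  forall e : R, 0 < e ->
    \forall n \near \oo, normc (csum u - \sum_(j < n) u j) < e.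
Proof.
move=> [M uM].
have part (f : C -> R) : (forall z, `|f z| <= normc z) ->
    exists a : R, forall e : R, 0 < e ->
      \forall n \near \oo, `|a - \sum_(j < n) f (u j)| < e.
  move=> fle; suff /cvg_ex[a /cvgrPdist_lt ha] : cvg (series (f \o u) @ \oo).
    exists a => e /ha; apply: filterS => n.
    by rewrite /series /= big_mkord.
  apply: normed_cvg; apply: nondecreasing_is_cvgn.
    by apply: nondecreasing_series => n _ _; exact: normr_ge0.
  exists M => _ [n _ <-] /=; rewrite -[leLHS]/(\sum_(0 <= k < n) `|f (u k)|) big_mkord.
  by apply: le_trans (uM n); apply: ler_sum.
have [[a ha] [b hb]] := (part _ normc_Re, part _ normc_Im).
have : (series u : nat -> C^o) @ \oo --> ((a +i* b)%C : C^o).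
  apply/cvgcP => e e0.
  move: ha hb => /(_ (e / 2)) + /(_ (e / 2)).
  rewrite divr_gt0// => /(_ isT) ha /(_ isT) hb.
  apply: filterS2 ha hb => n ha hb; rewrite (splitr e).
  apply: (le_lt_trans (normc_le_ReIm _)).
  have RI (f : {additive C -> R}) : f (series u n) = \sum_(j < n) f (u j).
    by rewrite /series /= big_mkord raddf_sum.
  by rewrite [complex.Re _]raddfB [complex.Im _]raddfB /= !RI ltrD.
move=> h; have := h; move/(cvg_lim (@norm_hausdorff _ _)); rewrite -/(csum u) => ->.
move/cvgcP : h => h e e0; apply: filterS (h e e0) => n.
by rewrite /series /= big_mkord.
Qed.

Lemma csum_unique u (l : C) :
  (forall e : R, 0 < e ->
    \forall n \near \oo, normc (l - \sum_(j < n) u j) < e) -> csum u = l.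
Proof.
move=> h; apply: (@cvg_lim C^o (@norm_hausdorff _ C^o) _ _ _ (series u) l).
apply/cvgcP => e e0.
by apply: filterS (h e e0) => n; rewrite /series /= big_mkord.
Qed.

Lemma near_le_eps (a b : R) (F : nat -> R) :
  (forall e : R, 0 < e -> \forall n \near \oo, F n < e) ->
  (\forall n \near \oo, a <= b + F n) -> a <= b.
Proof.
move=> Fe ab; apply/ler_addgt0Pr => e e0.
near \oo => n; have : a <= b + F n by near: n.
have : F n < e by near: n; exact: Fe.
by move=> ? ?; lra.
Unshelve. all: by end_near. Qed.

Lemma big_ord_split (V : zmodType) (F : nat -> V) m n : (m <= n)%N ->
  \sum_(j < n) F j = \sum_(j < m) F j + \sum_(m <= j < n) F j.
Proof. by move=> mn; rewrite -!(big_mkord xpredT) (@big_cat_nat _ _ _ m). Qed.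

(** Later measures the truncation error of each matrix entry. *)
Lemma csum_dist_le u (c : R) m : abs_summable u ->
  (forall n, (m <= n)%N -> normc (\sum_(m <= j < n) u j) <= c) ->
  normc (csum u - \sum_(j < m) u j) <= c.
Proof.
move=> us uc; apply: (@near_le_eps _ _ _ (csum_cvg us)).
near=> n; have mn : (m <= n)%N by near: n; exact: nbhs_infty_ge.
rewrite (_ : _ - _ = (\sum_(m <= j < n) u j) + (csum u - \sum_(j < n) u j)).
  by apply: le_trans (le_normcD _ _) _; rewrite lerD2r; exact: uc.
by rewrite (big_ord_split _ mn) opprD addrCA; congr (_ + _); rewrite addrCA subrr addr0.
Unshelve. all: by end_near. Qed.

Lemma csum_le u (c : R) : (forall n, \sum_(j < n) normc (u j) <= c) ->
  normc (csum u) <= c.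
Proof.
move=> uc; have := @csum_dist_le u c 0 (ex_intro _ c uc).
rewrite big_ord0 subr0; apply=> n _; rewrite big_mkord.
by apply: le_trans (uc n); exact: normc_sum.
Qed.

Lemma csum_lin (a : C) u v : abs_summable u -> abs_summable v ->
  csum (fun j => a * u j + v j) = a * csum u + csum v.
Proof.
move=> us vs; apply: csum_unique => e e0.
have n1 : 0 < 2 * (normc a + 1) :> R by rewrite mulr_gt0// ltr_wpDl ?normc_ge0.
have := csum_cvg vs (divr_gt0 e0 (ltr0Sn _ 1)).
have := csum_cvg us (divr_gt0 e0 n1); apply: filterS2 => n.
set A := csum u - _; set B := csum v - _ => hA hB.
rewrite (_ : _ - _ = a * A + B); last first.
  by rewrite big_split /= -mulr_sumr /A /B; ring.
rewrite (splitr e); apply: (le_lt_trans (le_normcD _ _)); apply: (ler_ltD _ hB).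
rewrite normcM; apply: (@le_trans _ _ ((normc a + 1) * (e / (2 * (normc a + 1))))).
  by apply: ler_pM; rewrite ?normc_ge0 ?ler_wpDr ?(ltW hA).
have : normc a + 1 != 0 by rewrite gt_eqF// ltr_wpDl ?normc_ge0.
by move=> ?; rewrite le_eqVlt; apply/orP; left; apply/eqP; field.
Qed.

Lemma csum_conj u : abs_summable u -> csum (fun j => (u j)^*%C) = (csum u)^*%C.
Proof.
move=> us; apply: csum_unique => e /(csum_cvg us); apply: filterS => n.
by rewrite -rmorph_sum -rmorphB normc_conj.
Qed.

Lemma csum_finite u m : (forall j, (m <= j)%N -> u j = 0) ->
  csum u = \sum_(j < m) u j.
Proof.
move=> u0; apply: csum_unique => e e0; near=> n.
have mn : (m <= n)%N by near: n; exact: nbhs_infty_ge.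
have -> : \sum_(j < n) u j = \sum_(j < m) u j.
  rewrite (big_ord_split _ mn) [X in _ + X]big_nat_cond [X in _ + X]big1 ?addr0//.
  by move=> j /andP[/andP[? _] _]; exact: u0.
by rewrite subrr normc0.
Unshelve. all: by end_near. Qed.

End Complex.

(** * The inner product of l2 *)

Section L2.
Variable R : realType.
Local Notation C := R[i].
Implicit Types (u v w : l2 R) (a : C) (x : cseq R).

Lemma wsum_leP q x (M : R) : (wsum q x <= M%:E)%E <->
  forall n, \sum_(j < n) (normc (x j) ^+ 2 * j.+1%:R ^ (q * 2)) <= M.
Proof.
have t0 j : true -> (0 <= (normc (x j) ^+ 2 * j.+1%:R ^ (q * 2))%:E :> \bar R)%E.
  by move=> _; exact: wterm_ge0.
split=> [h n|h].
  rewrite -lee_fin; apply: le_trans h; rewrite /wsum.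
  rewrite -sumEFin -(big_mkord xpredT
    (fun j => (normc (x j) ^+ 2 * j.+1%:R ^ (q * 2))%:E)).
  by apply: nneseries_lim_ge => j _ _; exact: t0.
apply: lime_le; first by apply: is_cvg_nneseries => j _ _; exact: t0.
by apply: nearW => n; rewrite sumEFin lee_fin big_mkord.
Qed.

Lemma wnorm_le q x (c : R) : 0 <= c ->
  (wnorm q x <= c%:E)%E = (wsum q x <= (c ^+ 2)%:E)%E.
Proof.
move=> c0; rewrite /wnorm; have := wsum_ge0 q x.
case: (wsum q x) => [r| |] //=; last first.
  by rewrite invr_eq0 pnatr_eq0/= !leye_eq.
rewrite lee_fin => r0; rewrite !lee_fin powR12_sqrt//.
by rewrite -[in RHS](sqr_sqrtr r0) ler_sqr ?nnegrE ?sqrtr_ge0.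
Qed.

Lemma wnorm_ltyP q x : (wnorm q x < +oo)%E <-> exists M, forall n,
  \sum_(j < n) (normc (x j) ^+ 2 * j.+1%:R ^ (q * 2)) <= M.
Proof.
rewrite wnorm_lty; split=> [h|[M /wsum_leP h]]; last first.
  by apply: le_lt_trans h _; rewrite ltry.
have := wsum_ge0 q x; move: h; case E : (wsum q x) => [r| |] // _ _.
by exists r; apply/wsum_leP; rewrite E.
Qed.

(** Taken from [inner] so that norm identities follow from sesquilinearity; [wsum_sqn] ties it to
    [wsum 0]. *)
Definition sqn u : R := complex.Re (inner u u).
Definition nrm u : R := Num.sqrt (sqn u).

Lemma wsum0E x n : \sum_(j < n) (normc (x j) ^+ 2 * j.+1%:R ^ (0 * 2)) =
  \sum_(j < n) normc (x j) ^+ 2 :> R.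
Proof. by apply: eq_bigr => j _; rewrite mul0r expr0z mulr1. Qed.

Lemma in_l2P x : reflect (exists M, forall n, \sum_(j < n) normc (x j) ^+ 2 <= M)
  (in_l2 x).
Proof.
apply: (iffP (asboolP _)) => [/wnorm_ltyP|] [M h].
  by exists M => n; rewrite -wsum0E.
by apply/wnorm_ltyP; exists M => n; rewrite wsum0E.
Qed.

Lemma innerE u v : inner u v = csum (fun j => l2_val u j * (l2_val v j)^*%C).
Proof. by []. Qed.

Lemma inner_summable u v :
  abs_summable (fun j => l2_val u j * (l2_val v j)^*%C).
Proof.
have [/in_l2P[M hM] /in_l2P[N hN]] := (l2P u, l2P v); exists (M + N) => n.
apply: le_trans (lerD (hM n) (hN n)); rewrite -big_split; apply: ler_sum => j _.
rewrite normcM normc_conj /=; set A := normc _; set B := normc _.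
have : 0 <= (A - B) ^+ 2 by exact: sqr_ge0.
have : 0 <= A ^+ 2 + B ^+ 2 by rewrite addr_ge0// sqr_ge0.
by rewrite sqrrB; lra.
Qed.

Lemma wsum_inner u : exists2 r : R, wsum 0 u = r%:E & inner u u = r%:C.
Proof.
have /asboolP := l2P u; rewrite wnorm_lty; have := wsum_ge0 0 u.
case E : (wsum 0 u) => [r| |] // _ _; exists r => //.
have up n : \sum_(j < n) normc (l2_val u j) ^+ 2 <= r.
  by rewrite -wsum0E; move: n; apply/wsum_leP; rewrite E.
rewrite innerE; apply: csum_unique => e e0.
have [m hm] : exists m, r - e < \sum_(j < m) normc (l2_val u j) ^+ 2.
  apply: contrapT => /forallNP h.
  have : (wsum 0 u <= (r - e)%:E)%E.
    by apply/wsum_leP => n; rewrite wsum0E leNgt; apply/negP/h.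
  by rewrite E lee_fin; lra.
near=> n; have mn : (m <= n)%N by near: n; exact: nbhs_infty_ge.
under eq_bigr do rewrite mul_conjc.
rewrite -raddf_sum -raddfB normc_real ger0_norm ?subr_ge0// ltrBlDr -ltrBlDl.
apply: (lt_le_trans hm).
rewrite (big_ord_split (fun j => normc (l2_val u j) ^+ 2) mn) lerDl.
by apply: sumr_ge0 => j _; exact: sqr_ge0.
Unshelve. all: by end_near. Qed.

Lemma inner_self u : inner u u = (sqn u)%:C.
Proof. by rewrite /sqn; have [r _ ->] := wsum_inner u. Qed.

Lemma wsum_sqn u : wsum 0 u = (sqn u)%:E.
Proof. by rewrite /sqn; have [r -> ->] := wsum_inner u. Qed.

Lemma sqn_ge0 u : 0 <= sqn u.
Proof. by rewrite -lee_fin -wsum_sqn wsum_ge0. Qed.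

Lemma nrm_ge0 u : 0 <= nrm u. Proof. exact: sqrtr_ge0. Qed.

Lemma nrm_sq u : nrm u ^+ 2 = sqn u.
Proof. by rewrite sqr_sqrtr// sqn_ge0. Qed.

Lemma wnorm_nrm u : wnorm 0 u = (nrm u)%:E.
Proof. by rewrite /wnorm wsum_sqn poweR_EFin powR12_sqrt// sqn_ge0. Qed.

Lemma sqn_leP u (M : R) : sqn u <= M <->
  forall n, \sum_(j < n) normc (l2_val u j) ^+ 2 <= M.
Proof.
rewrite -lee_fin -wsum_sqn; split=> [/wsum_leP h n|h].
  by rewrite -wsum0E.
by apply/wsum_leP => n; rewrite wsum0E.
Qed.

Lemma partial_sqn_le u n : \sum_(j < n) normc (l2_val u j) ^+ 2 <= sqn u.
Proof. by move: n; apply/sqn_leP. Qed.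

Lemma inner_conj u v : inner v u = (inner u v)^*%C.
Proof.
rewrite !innerE -(csum_conj (inner_summable u v)); congr csum.
by apply/funext => j; rewrite rmorphM/= conjcK mulrC.
Qed.

Lemma inner_linl a u v w : inner (a *: u + v) w = a * inner u w + inner v w.
Proof.
rewrite !innerE -csum_lin; [|exact: inner_summable..]; congr csum.
by apply/funext => j; rewrite mulrA -mulrDl.
Qed.

Lemma innerDl u v w : inner (u + v) w = inner u w + inner v w.
Proof. by rewrite -[u in LHS]scale1r inner_linl mul1r. Qed.

Lemma inner0l w : inner 0 w = 0.
Proof. by apply: (addrI (inner 0 w)); rewrite -innerDl !addr0. Qed.

Lemma innerZl a u w : inner (a *: u) w = a * inner u w.
Proof. by rewrite -[a *: u]addr0 inner_linl inner0l addr0. Qed.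

Lemma innerNl u w : inner (- u) w = - inner u w.
Proof. by rewrite -scaleN1r innerZl mulN1r. Qed.

Lemma innerBl u v w : inner (u - v) w = inner u w - inner v w.
Proof. by rewrite innerDl innerNl. Qed.

Lemma inner_suml (I : Type) (r : seq I) (Q : pred I) (F : I -> l2 R) w :
  inner (\sum_(k <- r | Q k) F k) w = \sum_(k <- r | Q k) inner (F k) w.
Proof.
by apply: (big_ind2 (fun u z => inner u w = z)) => [|u z v z' <- <-|//];
  rewrite (inner0l, innerDl).
Qed.

Lemma innerDr u v w : inner w (u + v) = inner w u + inner w v.
Proof. by rewrite !(inner_conj _ w) innerDl rmorphD. Qed.

Lemma inner0r w : inner w 0 = 0.
Proof. by rewrite inner_conj inner0l rmorph0. Qed.

Lemma innerZr a u w : inner w (a *: u) = a^*%C * inner w u.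
Proof. by rewrite !(inner_conj _ w) innerZl rmorphM. Qed.

Lemma innerNr u w : inner w (- u) = - inner w u.
Proof. by rewrite !(inner_conj _ w) innerNl rmorphN. Qed.

Lemma innerBr u v w : inner w (u - v) = inner w u - inner w v.
Proof. by rewrite innerDr innerNr. Qed.

Lemma inner_sumr (I : Type) (r : seq I) (Q : pred I) (F : I -> l2 R) w :
  inner w (\sum_(k <- r | Q k) F k) = \sum_(k <- r | Q k) inner w (F k).
Proof.
by apply: (big_ind2 (fun u z => inner w u = z)) => [|u z v z' <- <-|//];
  rewrite (inner0r, innerDr).
Qed.

Lemma sqn0 : sqn 0 = 0. Proof. by rewrite /sqn inner0l. Qed.

Lemma sqn_eq0 u : sqn u = 0 -> u = 0.
Proof.
move=> u0; apply/val_inj/funext => j; apply: eq0_normc; apply/eqP.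
rewrite -sqrf_eq0 eq_le sqr_ge0 andbT -[leRHS]u0.
apply: le_trans (partial_sqn_le u j.+1); rewrite big_ord_recr/= lerDr.
by apply: sumr_ge0 => k _; exact: sqr_ge0.
Qed.

Lemma coord_sqn_le u j : normc (l2_val u j) ^+ 2 <= sqn u.
Proof.
apply: le_trans (partial_sqn_le u j.+1); rewrite big_ord_recr/= lerDr.
by apply: sumr_ge0 => k _; exact: sqr_ge0.
Qed.

Lemma sqnZ a u : sqn (a *: u) = normc a ^+ 2 * sqn u.
Proof.
apply: complexI; rewrite -inner_self innerZl innerZr inner_self mulrA mul_conjc.
by rewrite -rmorphM.
Qed.

Lemma nrmZ a u : nrm (a *: u) = normc a * nrm u.
Proof. by rewrite /nrm sqnZ sqrtrM ?sqr_ge0// sqrtr_sqr ger0_norm// normc_ge0. Qed.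

Lemma sqnN u : sqn (- u) = sqn u.
Proof. by rewrite /sqn innerNl innerNr opprK. Qed.

Lemma sqnD u v : sqn (u + v) = sqn u + sqn v + 2 * complex.Re (inner u v).
Proof.
rewrite /sqn innerDl !innerDr !raddfD/= (inner_conj u v).
by case: (inner u v) => p q /=; ring.
Qed.

Lemma sqnB u v : sqn (u - v) = sqn u + sqn v - 2 * complex.Re (inner u v).
Proof. by rewrite sqnD sqnN innerNr raddfN/= mulrN. Qed.

Lemma inner_le u v : normc (inner u v) ^+ 2 <= sqn u * sqn v.
Proof.
have [v0|v0] := eqVneq (sqn v) 0.
  by rewrite (sqn_eq0 v0) inner0r normc0 expr0n sqn0 mulr0.
(* [w] is [sqn v] times the component of [u] orthogonal to [v]. *)
pose w := (sqn v)%:C *: u - inner u v *: v.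
have : 0 <= sqn w by exact: sqn_ge0.
have -> : sqn w = sqn v * (sqn u * sqn v - normc (inner u v) ^+ 2).
  rewrite sqnB !sqnZ innerZl innerZr normc_real real_normK ?num_real//.
  have := mul_conjc (inner u v); rewrite mulrC => ->.
  by rewrite -rmorphM/=; ring.
by rewrite pmulr_rge0 ?subr_ge0// lt_neqAle eq_sym v0 sqn_ge0.
Qed.

Lemma inner_le_nrm u v : normc (inner u v) <= nrm u * nrm v.
Proof.
rewrite -(ler_pXn2r (n := 2)) ?nnegrE ?mulr_ge0 ?normc_ge0 ?nrm_ge0//.
by rewrite exprMn !nrm_sq inner_le.
Qed.

Lemma nrmD u v : nrm (u + v) <= nrm u + nrm v.
Proof.
rewrite -(ler_pXn2r (n := 2)) ?nnegrE ?addr_ge0 ?nrm_ge0//.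
rewrite sqrrD !nrm_sq sqnD.
have := le_trans (ler_norm _) (le_trans (normc_Re (inner u v)) (inner_le_nrm u v)).
by lra.
Qed.

Lemma delta_subproof i :
  in_l2 ((fun j => if j == i then 1 else 0) : cseq R).
Proof.
apply/in_l2P; exists 1 => n; apply: (@le_trans _ _
    (\sum_(j < n) (if (j : nat) == i then 1 else 0 : R))).
  apply: ler_sum => j _; case: ifP => _; first by rewrite normc1 expr1n.
  by rewrite normc0 expr0n.
rewrite -big_mkcond sumr_const -[leRHS]mulr1n ler_wpMn2l//.
apply/card_le1_eqP => p q /eqP pi /eqP qi; apply/val_inj.
by move: pi qi => /= -> ->.
Qed.

Definition delta i : l2 R := L2 (delta_subproof i).

Lemma inner_delta u i : inner u (delta i) = l2_val u i.
Proof.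
rewrite innerE (@csum_finite _ _ i.+1) /=; last first.
  by move=> j ij; rewrite gtn_eqF// rmorph0 mulr0.
rewrite big_ord_recr /= eqxx rmorph1 mulr1 big1 ?add0r// => j _.
by rewrite ltn_eqF// rmorph0 mulr0.
Qed.

Lemma nrm_delta i : nrm (delta i) = 1.
Proof. by rewrite /nrm /sqn inner_delta /= eqxx sqrtr1. Qed.

(** The condition on [inner u (v k)] makes [v k] the component of [u] along its own line, so one
    form serves both for [inner u e *: e] with a unit vector [e] and for [P k u]. The remainder [w]
    is orthogonal to every [v k], and [sqn w] is the difference of the two sides. *)
Lemma bessel (I : finType) (Q : pred I) (v : I -> l2 R) u :
  (forall k l, Q k -> Q l -> k != l -> inner (v k) (v l) = 0) ->
  (forall k, Q k -> inner u (v k) = (sqn (v k))%:C) ->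
  \sum_(k | Q k) sqn (v k) <= sqn u.
Proof.
move=> ov uv; pose w := u - \sum_(k | Q k) v k.
have vw k : Q k -> inner (v k) w = 0.
  move=> Qk; rewrite innerBr inner_sumr (bigD1 k)//= big1 => [|l /andP[Ql lk]].
    by rewrite addr0 inner_self inner_conj uv// conjc_real subrr.
  by apply: ov; rewrite // eq_sym.
have : 0 <= sqn w by exact: sqn_ge0.
rewrite {1}/sqn {1}/w innerBl inner_suml big1// subr0 innerBr inner_sumr.
rewrite (eq_bigr (fun k => (sqn (v k))%:C))// -raddf_sum inner_self -raddfB.
by rewrite /= subr_ge0.
Qed.

End L2.

(** * Rapidly decreasing matrices act from s' to s *)

Section RapidMatrices.
Variable R : realType.
Local Notation C := R[i].
Implicit Types (a b : nat -> R) (u : l2 R).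

Definition rapid a :=
  forall r, exists K : R, forall j, a j * j.+1%:R ^+ r <= K.

Lemma rapid_partial_sum a : rapid a ->
  exists2 M : R, 0 < M & forall n, \sum_(j < n) a j <= M.
Proof.
move=> /(_ 2)[K aK]; pose K' := Num.max K 1.
have K0 : 0 < K' by rewrite lt_max ltr01 orbT.
exists (2 * K'); first exact: mulr_gt0.
(* Terms are at most [K' / (j+1)^2]; the induction carries a telescoping bound, since
   [1/t^2 <= 2 (1/t - 1/(t+1))] for [t >= 1]. *)
move=> n; apply: (@le_trans _ _ (2 * K' * (1 - n.+1%:R^-1))); last first.
  by rewrite ger_pMr ?mulr_gt0// lerBlDr lerDl invr_ge0.
elim: n => [|n IH]; first by rewrite big_ord0 invr1 subrr mulr0.
rewrite big_ord_recr/=; apply: (le_trans (lerD IH (_ : _ <=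
  K' / n.+1%:R ^+ 2))).
  rewrite ler_pdivlMr ?exprn_gt0//; apply: le_trans (aK n) _.
  by rewrite le_max lexx.
rewrite -[n.+2%:R]natr1; set t : R := n.+1%:R.
have t1 : 1 <= t by rewrite ler1n.
have -> : 2 * K' * (1 - (t + 1)^-1) =
    2 * K' * (1 - t^-1) + K' / t ^+ 2 + K' * (t - 1) / (t ^+ 2 * (t + 1)).
  by field; rewrite !gt_eqF//; lra.
rewrite lerDl divr_ge0 ?mulr_ge0 ?exprn_ge0//; lra.
Qed.

Lemma rapidZ (c : R) a : 0 <= c -> rapid a -> rapid (fun j => c * a j).
Proof.
move=> c0 ra r; have [K aK] := ra r; exists (c * K) => j.
by rewrite -mulrA ler_wpM2l.
Qed.

Lemma rapid_weight a q : rapid a -> rapid (fun j => a j * j.+1%:R ^+ q).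
Proof.
move=> ra r; have [K aK] := ra (q + r)%N; exists K => j.
by rewrite -mulrA -exprD.
Qed.

Lemma rapid_sq a : (forall j, 0 <= a j) -> rapid a ->
  rapid (fun j => a j ^+ 2).
Proof.
move=> a0 ra r; have [K aK] := ra r; exists (K ^+ 2) => j.
apply: (@le_trans _ _ ((a j * j.+1%:R ^+ r) ^+ 2)).
  rewrite exprMn ler_wpM2l ?sqr_ge0// -exprM; apply: ler_weXn2l.
    by rewrite ler1n.
  by rewrite muln2 -addnn leq_addr.
by apply: lerXn2r; rewrite ?nnegrE ?mulr_ge0 ?exprn_ge0// (le_trans _ (aK j))//
  mulr_ge0 ?exprn_ge0.
Qed.

Lemma weightE j (q : nat) : j.+1%:R ^ (q%:Z * 2) = (j.+1%:R ^+ q) ^+ 2 :> R.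
Proof. by rewrite -exprM -exprnP. Qed.

Lemma weightNE j (q : nat) :
  j.+1%:R ^ (- q%:Z * 2) = ((j.+1%:R ^+ q) ^+ 2)^-1 :> R.
Proof. by rewrite mulNr -invr_expz weightE. Qed.

Lemma s'_growth (v : cseq R) (q : nat) (M : R) : 0 <= M ->
  (wnorm (- q%:Z) v <= M%:E)%E ->
  forall j, normc (v j) <= M * j.+1%:R ^+ q.
Proof.
move=> M0; rewrite wnorm_le// => /wsum_leP h j.
rewrite -(ler_pXn2r (n := 2)) ?nnegrE ?normc_ge0 ?mulr_ge0 ?exprn_ge0//.
rewrite exprMn -ler_pdivrMr ?exprn_gt0//; apply: le_trans (h j.+1).
rewrite big_ord_recr/= weightNE lerDr; apply: sumr_ge0 => k _.
by rewrite weightNE mulr_ge0 ?sqr_ge0// invr_ge0 sqr_ge0.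
Qed.

Lemma s'_pairing a (v : s' R) : (forall j, 0 <= a j) -> rapid a ->
  exists2 L : R, 0 <= L & forall n, \sum_(j < n) (a j * normc (s'_val v j)) <= L.
Proof.
move=> a0 ra; have /asboolP[q] := s'P v.
rewrite wnorm_lty; have := wsum_ge0 (- q%:Z) v.
case E : (wsum _ _) => [r| |] // r0 _.
have [M M0 aM] := rapid_partial_sum (rapid_weight q ra).
exists (M * Num.sqrt r); first by rewrite mulr_ge0 ?sqrtr_ge0// ltW.
move=> n; apply: (@le_trans _ _ (\sum_(j < n) (a j * j.+1%:R ^+ q * Num.sqrt r))).
  apply: ler_sum => j _; rewrite -mulrA ler_wpM2l// mulrC.
  apply: s'_growth; rewrite ?sqrtr_ge0// wnorm_le ?sqrtr_ge0// E.
  by rewrite sqr_sqrtr.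
by rewrite -mulr_suml ler_wpM2r ?sqrtr_ge0.
Qed.

Section Operator.
Variables (a : nat -> R) (m : nat -> nat -> C).
Hypotheses (a0 : forall j, 0 <= a j) (ra : rapid a).
Hypothesis ma : forall i j, normc (m i j) <= a i * a j.

Let Tfun (v : cseq R) : cseq R := fun i => csum (fun j => m i j * v j).

Let Tfun_le (v : cseq R) (L : R) :
  (forall n, \sum_(j < n) (a j * normc (v j)) <= L) ->
  forall i n, \sum_(j < n) normc (m i j * v j) <= a i * L.
Proof.
move=> vL i n; apply: (@le_trans _ _ (a i * \sum_(j < n) (a j * normc (v j)))).
  rewrite mulr_sumr; apply: ler_sum => j _; rewrite normcM mulrA.
  by rewrite ler_wpM2r ?normc_ge0.
by rewrite ler_wpM2l.
Qed.

(** Every norm of the image is governed by the single quantity [sum_j a_j |v_j|]: the row bound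
    [a i * L] leaves only the weighted square sum of [a], finite for each [q]. *)
Let Tfun_wnorm (q : nat) : exists2 K : R, 0 < K & forall (v : cseq R) (L : R),
  0 <= L -> (forall n, \sum_(j < n) (a j * normc (v j)) <= L) ->
  (wnorm q%:Z (Tfun v) <= (L * K)%:E)%E.
Proof.
have aw0 j : 0 <= a j * j.+1%:R ^+ q by rewrite mulr_ge0 ?exprn_ge0.
have [M M0 aM] := rapid_partial_sum (rapid_sq aw0 (rapid_weight q ra)).
exists (Num.sqrt M); first by rewrite sqrtr_gt0.
move=> v L L0 vL; rewrite wnorm_le ?mulr_ge0 ?sqrtr_ge0//; apply/wsum_leP => n.
rewrite exprMn sqr_sqrtr ?(ltW M0)//; apply: le_trans (ler_wpM2l _ (aM n)).
  rewrite mulr_sumr; apply: ler_sum => i _; rewrite weightE -exprMn -exprMn.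
  apply: lerXn2r; rewrite ?nnegrE ?mulr_ge0 ?normc_ge0 ?exprn_ge0//.
  rewrite mulrA ler_wpM2r ?exprn_ge0// mulrC.
  by apply: csum_le => k; exact: Tfun_le.
exact: sqr_ge0.
Qed.

Let T_in_s (v : s' R) : in_s (Tfun v).
Proof.
apply/asboolP => q; have [K K0 h] := Tfun_wnorm q.
have [L L0 vL] := s'_pairing v a0 ra.
by apply: (le_lt_trans (h v L L0 vL)); rewrite ltry.
Qed.

Let T v : s R := S_ (T_in_s v).

Let T_summable (v : s' R) i : abs_summable (fun j => m i j * s'_val v j).
Proof.
have [L L0 vL] := s'_pairing v a0 ra; exists (a i * L); exact: Tfun_le.
Qed.

Let T_linear : linear T.
Proof.
move=> c u v; apply/val_inj/funext => i.
apply: etrans (csum_lin c (T_summable u i) (T_summable v i)).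
rewrite -[LHS]/(csum (fun j => m i j * s'_val (c *: u + v) j)).
by congr csum; apply/funext => j; rewrite mulrCA -mulrDr.
Qed.

HB.instance Definition _ :=
  GRing.isLinear.Build C (s' R) (s R) *:%R T T_linear.

(* The sets [sum_j a_j |v_j| <= d] are absolutely convex neighbourhoods of 0 in
   s' whose images lie in the ball of radius [d K] of |.|_q; choosing them
   avoids the triangle inequality for the weighted norms. *)
Let T_continuous : continuous T.
Proof.
apply/continuousP => U oU; rewrite -[open _]/(s'_open (T @^-1` U)) => x Ux.
have [q [e [e0 hU]]] := oU _ Ux.
have [K K0 hK] : exists2 K : R, 0 < K & forall (v : cseq R) (L : R), 0 <= L ->
    (forall n, \sum_(j < n) (a j * normc (v j)) <= L) ->
    forall k, (k <= q)%N -> (wnorm k%:Z (Tfun v) <= (L * K)%:E)%E.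
  have [K K0 h] := Tfun_wnorm q; exists K => // v L L0 vL k kq.
  have := h v L L0 vL; rewrite !wnorm_le ?mulr_ge0 ?(ltW K0)//; apply: le_trans.
  apply: lee_nneseries => [j _ _|j _]; first exact: wterm_ge0.
  rewrite lee_fin ler_wpM2l ?sqr_ge0// !weightE.
  by apply: lerXn2r; rewrite ?nnegrE ?exprn_ge0// ler_weXn2l ?ler1n.
pose d := e / (2 * K); have d0 : 0 < d by rewrite divr_gt0 ?mulr_gt0.
exists [set v | forall n, \sum_(j < n) (a j * normc (s'_val v j)) <= d].
split; [split|].
- move=> u v c c' hu hv cc n.
  have cc' : normc c + normc c' <= 1.
    by move: cc; rewrite !normrcE -rmorphD lecR.
  apply: (@le_trans _ _ ((normc c + normc c') * d)); last first.
    by rewrite ger_pMl.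
  rewrite mulrDl; apply: le_trans (lerD (ler_wpM2l (normc_ge0 c) (hu n))
    (ler_wpM2l (normc_ge0 c') (hv n))).
  rewrite !mulr_sumr -big_split; apply: ler_sum => j _ /=.
  rewrite !(mulrCA (normc _)) -mulrDr ler_wpM2l// -!normcM.
  exact: (le_normcD (c * s'_val u j) (c' * s'_val v j)).
- move=> p; have [M M0 aM] := rapid_partial_sum (rapid_weight p ra).
  exists (d / M); split=> [|u hu n]; first exact: divr_gt0.
  apply: (@le_trans _ _ (\sum_(j < n) (a j * j.+1%:R ^+ p * (d / M)))).
    apply: ler_sum => j _; rewrite -mulrA ler_wpM2l// mulrC.
    by apply: (@s'_growth _ p); [exact/ltW/divr_gt0|exact: ltW].
  rewrite -mulr_suml; apply: le_trans (ler_wpM2r _ (aM n)) _.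
    exact/ltW/divr_gt0.
  by rewrite mulrCA divff ?mulr1// gt_eqF.
- move=> v hv; apply: hU => k kq.
  rewrite (_ : T (x + v) - T x = T v); last by rewrite raddfD addrAC subrr add0r.
  apply: (le_lt_trans (hK v d (ltW d0) hv k kq)).
  rewrite lte_fin /d invfM mulrA -mulrA mulVf ?gt_eqF// mulr1.
  by rewrite ltr_pdivrMr// ltr_pMr// ltr1n.
Qed.

Let y_in_l2 u : in_l2 (T (l2_s' u)).
Proof. by have /asboolP/(_ 0) h := sP (T (l2_s' u)); apply/asboolP. Qed.

Let y u : l2 R := L2 (y_in_l2 u).

Let y_linear : linear y.
Proof.
move=> c u v; apply/val_inj.
have uv : l2_s' (c *: u + v) = c *: l2_s' u + l2_s' v by exact/val_inj.
by rewrite -[LHS]/(s_val (T (l2_s' (c *: u + v)))) uv linearP.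
Qed.

HB.instance Definition _ :=
  GRing.isLinear.Build C (l2 R) (l2 R) *:%R y y_linear.

Lemma rapid_matrix_Ls's : exists y : {linear l2 R -> l2 R}, in_Ls's y /\
  forall u i, l2_val (y u) i = csum (fun j => m i j * l2_val u j).
Proof. by exists y; split=> //; exists T. Qed.

End Operator.

(* The vectors [j^r e_j] are bounded in s', so their images are bounded in l2. *)
Lemma Ls's_decay (x : l2 R -> l2 R) : in_Ls's x ->
  rapid (fun j => nrm (x (delta R j))).
Proof.
move=> [T [cT Tx]] r.
have s_l2 (z : s R) : in_l2 z.
  by have /asboolP/(_ 0) h := sP z; apply/asboolP.
pose U : set (s R) := [set z | nrm (L2 (s_l2 z)) < 1].
have oU : open U.
  move=> z Uz; exists 0%N, (1 - nrm (L2 (s_l2 z))); split=> [|w /(_ 0%N isT)].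
    by rewrite subr_gt0.
  rewrite -[s_val _]/(l2_val (L2 (s_l2 w) - L2 (s_l2 z))) wnorm_nrm lte_fin.
  move=> h; have := nrmD (L2 (s_l2 w) - L2 (s_l2 z)) (L2 (s_l2 z)).
  by rewrite subrK /U /=; lra.
have U0 : U (T 0).
  rewrite /U /= /nrm (_ : L2 _ = 0) ?sqn0 ?sqrtr0//.
  by apply/val_inj; rewrite /= linear0.
have := open_comp (fun z _ => cT z) oU => oTU.
have [V [[_ nV] hV]] := oTU 0 U0; have [e [e0 he]] := nV r.
(* [t] gives [t e_j] the norm [e / 2] in [|.|'_r], inside the ball of radius [e], so the image of
   [t e_j] has [l2] norm below 1. *)
exists (2 / e) => j; pose t : R := j.+1%:R ^+ r * (e / 2).
have t0 : 0 < t by rewrite mulr_gt0 ?exprn_gt0// divr_gt0.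
have Ut : U (T (l2_s' (t%:C *: delta R j))).
  rewrite -[l2_s' _]add0r; apply: hV; apply: he.
  apply: (@le_lt_trans _ _ (e / 2)%:E); last by rewrite lte_fin; lra.
  have e2 : 0 <= e / 2 by rewrite divr_ge0// ltW.
  rewrite wnorm_le//; apply/wsum_leP => n.
  apply: (@le_trans _ _ (\sum_(k < n)
      (if (k : nat) == j then (e / 2) ^+ 2 else 0))).
    apply: ler_sum => k _.
    rewrite -[s'_val _ k]/((t%:C * (if (k : nat) == j then 1 else 0) : C)).
    case: eqP => [->|_]; last by rewrite mulr0 normc0 expr0n mul0r.
    rewrite mulr1 normc_real ger0_norm ?(ltW t0)// weightNE /t exprMn mulrAC.
    by rewrite divff ?mul1r// expf_neq0// expf_neq0.
  rewrite -big_mkcond sumr_const -[leRHS]mulr1n ler_wpMn2l ?sqr_ge0//.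
  apply/card_le1_eqP => p q /eqP pi /eqP qi; apply/val_inj.
  by move: pi qi => /= -> ->.
have : nrm (t%:C *: x (delta R j)) < 1.
  move: Ut; rewrite /U /=; congr (nrm _ < 1); apply/val_inj => /=.
  rewrite (_ : l2_s' _ = t%:C *: l2_s' (delta R j)); last exact/val_inj.
  by rewrite linearZ -[LHS]/(t%:C *: s_val (T (l2_s' (delta R j)))) Tx.
rewrite nrmZ normc_real ger0_norm ?(ltW t0)// /t => h.
rewrite ler_pdivlMr//; move: h; set A := nrm _; set B := _ ^+ _ => h.
by rewrite [leLHS](_ : _ = 2 * (B * (e / 2) * A)); [lra|field].
Qed.

End RapidMatrices.

(** * Weak limits in l2 *)

Section WeakCompactness.
Variable R : realType.
Local Notation C := R[i].
Implicit Types (u v : l2 R).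

(** Compactness of the segment gives a cluster point, and along an ultrafilter a cluster point is a
    limit. *)
Lemma ultra_cvg_bounded (T : Type) (F : set_system T) (f : T -> R) (c : R) :
  UltraFilter F -> (forall t, `|f t| <= c) ->
  exists p : R, forall e : R, 0 < e -> \forall t \near F, `|p - f t| < e.
Proof.
move=> FU fc; have FP := ultra_proper.
have [p [_ clp]] : `[(- c), c]%classic `&` cluster (f @ F) !=set0.
  apply: (@segment_compact R (- c) c (f @ F) _).
  suff : F (f @^-1` `[(- c), c]) by [].
  by apply: filterE => t; rewrite /= in_itv/= -ler_norml.
exists p => e e0; pose A := [set t | `|p - f t| < e].
have [//|nA] := in_ultra_setVsetC A FU.
have [q [+ qp]] := clp (f @` (~` A)) (ball p e)
  (filterS (@preimage_image _ _ f _) nA) (nbhsx_ballx p e e0).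
by move=> [t At tq]; case: At; rewrite /A/= tq.
Qed.

(** A single ultrafilter makes all coordinates converge, in place of a diagonal subsequence. *)
Lemma weak_limit (F : set_system nat) (xi : nat -> l2 R) : UltraFilter F ->
  (forall n, sqn (xi n) <= 1) ->
  exists2 u, sqn u <= 1 & forall j (e : R), 0 < e ->
    \forall n \near F, normc (l2_val (xi n) j - l2_val u j) < e.
Proof.
move=> FU xi1; have FP := ultra_proper.
have c1 n j : normc (l2_val (xi n) j) <= 1.
  rewrite -(ler_pXn2r (n := 2)) ?nnegrE ?normc_ge0// expr1n.
  exact: le_trans (coord_sqn_le _ _) (xi1 n).
have /choice[p hp] j := @ultra_cvg_bounded _ F
  (fun n => complex.Re (l2_val (xi n) j)) 1 FU
  (fun n => le_trans (normc_Re _) (c1 n j)).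
have /choice[q hq] j := @ultra_cvg_bounded _ F
  (fun n => complex.Im (l2_val (xi n) j)) 1 FU
  (fun n => le_trans (normc_Im _) (c1 n j)).
pose w : cseq R := fun j => (p j +i* q j)%C.
have wl j (e : R) : 0 < e ->
    \forall n \near F, normc (l2_val (xi n) j - w j) < e.
  move=> e0; have e2 : 0 < e / 2 by rewrite divr_gt0.
  apply: filterS2 (hp j _ e2) (hq j _ e2) => n hpn hqn.
  rewrite normcB; apply: (le_lt_trans (normc_le_ReIm _)).
  by rewrite [complex.Re _]raddfB [complex.Im _]raddfB /= (splitr e) ltrD.
have w1 n : \sum_(j < n) normc (w j) ^+ 2 <= 1.
  (* One index approximates all of the first [n] coordinates within [e]; then
     [(B + e)^2 <= B^2 + e^2 + 2 e] because each coordinate modulus [B] is at most 1. *)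
  suff h (e : R) : 0 < e -> \sum_(j < n) normc (w j) ^+ 2 <=
      1 + n%:R * (e ^+ 2 + 2 * e).
    apply/ler_addgt0Pr => e e0.
    pose d := Num.min 1 (e / (3 * n.+1%:R)).
    have d0 : 0 < d by rewrite lt_min ltr01 divr_gt0 ?mulr_gt0.
    apply: le_trans (h d d0) _; rewrite lerD2l.
    have d1 : d <= 1 by rewrite ge_min lexx.
    have de : d * (3 * n.+1%:R) <= e.
      by rewrite -ler_pdivlMr ?mulr_gt0// ge_min lexx orbT.
    apply: le_trans de; apply: (@le_trans _ _ (n%:R * (3 * d))).
      by rewrite ler_wpM2l//; nra.
    by rewrite -[n.+1%:R]natr1; nra.
  move=> e0.
  have : \forall t \near F, forall j : 'I_n, normc (l2_val (xi t) j - w j) < e.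
    by apply: filter_forall => j; exact: wl.
  move=> /filter_ex[t ht].
  apply: (@le_trans _ _
     (\sum_(j < n) (normc (l2_val (xi t) j) ^+ 2 + (e ^+ 2 + 2 * e)))).
    apply: ler_sum => j _; have := ht j; rewrite normcB => hj.
    have := le_normcD (l2_val (xi t) j) (w j - l2_val (xi t) j).
    rewrite addrC subrK => h.
    have := c1 t j; have := normc_ge0 (w j); have := normc_ge0 (l2_val (xi t) j).
    set A := normc (w j) in h *; set B := normc (l2_val _ j) in h *.
    move=> B0 A0 B1.
    have AB : A <= B + e by apply: (le_trans h); rewrite lerD2l ltW.
    have : A ^+ 2 <= (B + e) ^+ 2 by apply: lerXn2r; rewrite ?nnegrE ?addr_ge0// ltW.
    move=> AB2; apply: (le_trans AB2); nra.
  rewrite big_split /= sumr_const card_ord -[X in _ + X]mulr_natl lerD2r.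
  exact: le_trans (partial_sqn_le _ _) (xi1 t).
have wP : in_l2 w by apply/in_l2P; exists 1.
by exists (L2 wP) => //; apply/sqn_leP.
Qed.

Lemma inner_tail v (e : R) : 0 < e -> exists (m : nat) (z : l2 R),
  sqn z < e /\
  v = \sum_(j < m) l2_val v j *: delta R j + z.
Proof.
move=> e0.
have [m hm] : exists m, sqn v - e < \sum_(j < m) normc (l2_val v j) ^+ 2.
  apply: contrapT => /forallNP h.
  have : sqn v <= sqn v - e.
    by apply/sqn_leP => n; rewrite leNgt; apply/negP/h.
  by lra.
pose s := \sum_(j < m) l2_val v j *: delta R j.
exists m, (v - s); split; last by rewrite addrC subrK.
have vs : inner v s = (\sum_(j < m) normc (l2_val v j) ^+ 2)%:C.
  rewrite inner_sumr raddf_sum; apply: eq_bigr => j _.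
  by rewrite innerZr inner_delta mulrC mul_conjc.
have sd (j : 'I_m) : inner s (delta R j) = l2_val v j.
  rewrite inner_suml (bigD1 j)//= big1 => [|k kj].
    by rewrite addr0 innerZl inner_delta /= eqxx mulr1.
  by rewrite innerZl inner_delta /= eq_sym -(inj_eq val_inj) /= in kj *;
    rewrite (negbTE kj) mulr0.
have ss : sqn s = \sum_(j < m) normc (l2_val v j) ^+ 2.
  apply: complexI; rewrite -inner_self -vs {2 3}/s !inner_sumr.
  by apply: eq_bigr => j _; rewrite !innerZr sd inner_delta.
by rewrite sqnB ss vs /=; lra.
Qed.

Lemma weak_inner (F : set_system nat) (z : nat -> l2 R) v : Filter F ->
  (forall n, sqn (z n) <= 4) ->
  (forall j (e : R), 0 < e -> \forall n \near F, normc (l2_val (z n) j) < e) ->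
  forall e : R, 0 < e -> \forall n \near F, normc (inner (z n) v) < e.
Proof.
move=> FF z4 zc e e0.
(* The remainder has norm below [e/4]: paired with [z n], of norm at most 2, it costs less than
   [e/2]. *)
have [m [t [te ->]]] := inner_tail v (exprn_gt0 2 (divr_gt0 e0 (ltr0Sn R 3))).
pose K := \sum_(j < m) normc (l2_val v j).
have K0 : 0 <= K by apply: sumr_ge0 => j _; exact: normc_ge0.
have d0 : 0 < e / (2 * (K + 1)) by rewrite divr_gt0 ?mulr_gt0// ltr_wpDl.
have : \forall n \near F, forall j : 'I_m,
    normc (l2_val (z n) j) < e / (2 * (K + 1)).
  by apply: filter_forall => j; exact: zc.
apply: filterS => n hn; rewrite innerDr inner_sumr.
apply: (le_lt_trans (le_normcD _ _)); rewrite (splitr e); apply: ler_ltD.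
  apply: (le_trans (normc_sum _ _ _)).
  apply: (@le_trans _ _ (K * (e / (2 * (K + 1))))).
    rewrite mulr_suml; apply: ler_sum => j _.
    by rewrite innerZr inner_delta normcM normc_conj ler_wpM2l ?normc_ge0// ltW.
  rewrite invfM mulrA [leLHS](_ : _ = e / 2 * (K / (K + 1))); last by ring.
  by rewrite ger_pMr ?divr_gt0// ler_pdivrMr ?mul1r ?lerDl// ltr_wpDl.
apply: (le_lt_trans (inner_le_nrm _ _)).
rewrite -(ltr_pXn2r (n := 2)) ?nnegrE ?mulr_ge0 ?nrm_ge0 ?divr_ge0 ?(ltW e0)//.
rewrite exprMn !nrm_sq (_ : (e / 2) ^+ 2 = 4 * (e / 4) ^+ 2); last by field.
apply: (@le_lt_trans _ _ (4 * sqn t)); last by rewrite ltr_pM2l.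
by rewrite ler_wpM2r ?sqn_ge0.
Qed.

End WeakCompactness.

(** * Normal Hilbert-Schmidt operators *)

Section NormalOperator.
Variable R : realType.
Local Notation C := R[i].
Implicit Types (u v : l2 R).

Lemma tail_small (a : nat -> R) (M : R) : (forall j, 0 <= a j) ->
  (forall n, \sum_(j < n) a j <= M) -> forall e : R, 0 < e ->
  exists m, forall n, (m <= n)%N -> \sum_(m <= j < n) a j <= e.
Proof.
move=> a0 aM e e0; pose A := range (fun n => \sum_(j < n) a j).
have hA : has_sup A.
  by split; [exists (\sum_(j < 0) a j), 0%N|exists M => _ [n _ <-]].
have [_ [m _ <-] hm] := sup_adherent e0 hA.
exists m => n mn.
have : \sum_(j < n) a j <= sup A by apply: ub_le_sup; [case: hA|exists n].
by rewrite (big_ord_split a mn); lra.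
Qed.

Variables x xs : {linear l2 R -> l2 R}.
Hypothesis adj : adjoint_to x xs.
Hypothesis comm : x \o xs = xs \o x.
Variable M : R.
Hypothesis hs : forall n, \sum_(j < n) sqn (x (delta R j)) <= M.

Lemma adjC u v : inner (xs u) v = inner u (x v).
Proof. by rewrite inner_conj -adj -inner_conj. Qed.

Lemma commE u : x (xs u) = xs (x u).
Proof. exact: (congr1 (fun f => f u) comm). Qed.

Lemma sqn_adj u : sqn (xs u) = sqn (x u).
Proof. by rewrite /sqn adjC adj commE. Qed.

Lemma adj_coord u i : l2_val (xs u) i = inner u (x (delta R i)).
Proof. by rewrite -inner_delta adjC. Qed.

Lemma hs_ge0 : 0 <= M.
Proof. by apply: le_trans (hs 0); rewrite big_ord0. Qed.

Lemma op_bounded u : sqn (x u) <= M * sqn u.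
Proof.
rewrite -sqn_adj; apply/sqn_leP => n.
apply: (@le_trans _ _ (\sum_(j < n) sqn (x (delta R j)) * sqn u)).
  by apply: ler_sum => j _; rewrite adj_coord mulrC inner_le.
by rewrite -mulr_suml ler_wpM2r ?sqn_ge0.
Qed.

(** A normal operator and its adjoint have the same kernel, here applied to [x - l]. *)
Lemma eigen_adj (l : C) u : x u = l *: u -> xs u = l^*%C *: u.
Proof.
move=> xu; apply/eqP; rewrite -subr_eq0; apply/eqP/sqn_eq0; apply: complexI.
rewrite -inner_self innerBl !innerBr adjC commE -adj xu.
rewrite !(innerZl, innerZr) adjC -adj xu.
by rewrite  !(innerZl, innerZr) conjcK; ring.
Qed.

Lemma eigen_orth (l m : C) u v : l != m ->
  x u = l *: u -> x v = m *: v -> inner u v = 0.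
Proof.
move=> lm xu /eigen_adj xv.
have : inner (x u) v = inner u (xs v) by exact: adj.
rewrite xu xv innerZl innerZr conjcK => /eqP.
by rewrite -subr_eq0 -mulrBl mulf_eq0 subr_eq0 (negbTE lm) => /eqP.
Qed.

(** By [sqn_adj] the left side is the double sum of [|inner (e k) (x (delta R j))|^2]; summed over
    [k] first, Bessel bounds it by the columns. This yields finite multiplicities and finitely many
    eigenvalues away from 0. *)
Lemma hs_orthonormal n (e : 'I_n -> l2 R) :
  (forall k l, inner (e k) (e l) = (k == l)%:R) ->
  \sum_k sqn (x (e k)) <= M.
Proof.
move=> oe; rewrite -lee_fin -sumEFin.
under eq_bigr do rewrite -sqn_adj -wsum_sqn.
rewrite /wsum -nneseries_sum; last by move=> *; exact: wterm_ge0.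
apply: lime_le.
  by apply: is_cvg_nneseries => j _ _; apply: sume_ge0 => k _; exact: wterm_ge0.
apply: nearW => N; rewrite [leLHS](_ : _ = (\sum_(j < N) \sum_k
    (normc (l2_val (xs (e k)) j) ^+ 2))%:E); last first.
  rewrite -sumEFin big_mkord; apply: eq_bigr => j _; rewrite -sumEFin.
  by apply: eq_bigr => k _; rewrite mul0r expr0z mulr1.
rewrite lee_fin; apply: le_trans (hs N); apply: ler_sum => j _.
have be := @bessel R 'I_n xpredT
  (fun k => inner (x (delta R j)) (e k) *: e k) (x (delta R j)).
apply: (le_trans _ (be _ _)).
- apply: ler_sum => k _; rewrite sqnZ adj_coord inner_conj normc_conj.
  by rewrite /sqn oe eqxx mulr1.
- by move=> k l _ _ kl; rewrite innerZl innerZr oe (negbTE kl) !mulr0.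
- move=> k _; rewrite sqnZ innerZr /sqn oe eqxx mulr1 mulrC mul_conjc.
  by rewrite inner_conj normc_conj.
Qed.

(** Compactness of Hilbert-Schmidt operators: the first [m] coordinates of [xs (z n)] are small by
    weak convergence, the others uniformly by the square-summable columns. *)
Lemma op_weak_strong (F : set_system nat) (z : nat -> l2 R) : Filter F ->
  (forall n, sqn (z n) <= 4) ->
  (forall j (e : R), 0 < e -> \forall n \near F, normc (l2_val (z n) j) < e) ->
  forall e : R, 0 < e -> \forall n \near F, nrm (x (z n)) < e.
Proof.
move=> FF z4 zc e e0.
(* The tail will contribute at most [4 e^2/16] and the first [m] coordinates at most
   [m d^2 <= e^2/4], in all [e^2/2]. *)
have e8 : 0 < e ^+ 2 / 16 by rewrite divr_gt0 ?exprn_gt0.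
have [m hm] := tail_small (fun j => sqn_ge0 (x (delta R j))) hs e8.
pose d := e / (2 * (m.+1%:R)); have d0 : 0 < d by rewrite divr_gt0 ?mulr_gt0.
have : \forall n \near F, forall j : 'I_m,
    normc (inner (z n) (x (delta R j))) < d.
  by apply: filter_forall => j; exact: weak_inner.
apply: filterS => n hn.
rewrite -(ltr_pXn2r (n := 2)) ?nnegrE ?nrm_ge0 ?(ltW e0)// nrm_sq -sqn_adj.
apply: (@le_lt_trans _ _ (m%:R * d ^+ 2 + 4 * (e ^+ 2 / 16))).
  apply/sqn_leP => N.
  apply: (@le_trans _ _ (\sum_(j < m + N) normc (l2_val (xs (z n)) j) ^+ 2)).
    rewrite addnC (big_ord_split (fun j => normc (l2_val (xs (z n)) j) ^+ 2)
      (leq_addr m N)) lerDl.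
    by apply: sumr_ge0 => j _; exact: sqr_ge0.
  rewrite (big_ord_split (fun j => normc (l2_val (xs (z n)) j) ^+ 2)
      (leq_addr N m)); apply: lerD.
    rewrite mulr_natl -[X in _ *+ X]card_ord -sumr_const; apply: ler_sum => j _.
    rewrite adj_coord; apply: lerXn2r; rewrite ?nnegrE ?normc_ge0 ?(ltW d0)//.
    exact/ltW.
  apply: (@le_trans _ _ (\sum_(m <= j < m + N) 4 * sqn (x (delta R j)))).
    apply: ler_sum => j _; rewrite adj_coord; apply: (le_trans (inner_le _ _)).
    by rewrite ler_wpM2r ?sqn_ge0.
  by rewrite -mulr_sumr ler_wpM2l// hm// leq_addr.
have : m%:R * d ^+ 2 <= e ^+ 2 / 4.
  have -> : m%:R * d ^+ 2 = e ^+ 2 / 4 * (m%:R / m.+1%:R ^+ 2).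
    have : m.+1%:R != 0 :> R by [].
    by rewrite /d; move: (m.+1%:R : R) => t t0; field.
  rewrite ger_pMr ?divr_gt0 ?exprn_gt0// ler_pdivrMr ?exprn_gt0// mul1r.
  by rewrite -natrX ler_nat (leq_trans (leqnSn m))// leq_pmulr.
have : 0 < e ^+ 2 by exact: exprn_gt0.
lra.
Qed.

(* Along an ultrafilter a maximizing sequence converges weakly, and the quadratic
   form of a Hilbert-Schmidt operator is weakly continuous on the unit ball. *)
Lemma form_max (G : set (l2 R)) : exists xi : l2 R,
  [/\ forall v, G v -> inner xi v = 0, sqn xi <= 1 &
   forall eta, (forall v, G v -> inner eta v = 0) -> sqn eta <= 1 ->
     normc (inner (x eta) eta) <= normc (inner (x xi) xi)].
Proof.
pose N eta := (forall v, G v -> inner eta v = 0) /\ sqn eta <= 1.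
pose A := [set normc (inner (x eta) eta) | eta in N].
have hA : has_sup A.
  split.
    exists (normc (inner (x 0) 0)), 0 => //.
    by split=> [v _|]; rewrite ?inner0l ?sqn0.
  exists (Num.sqrt M) => _ [eta [_ eta1] <-].
  rewrite -(ler_pXn2r (n := 2)) ?nnegrE ?normc_ge0 ?sqrtr_ge0//.
  rewrite sqr_sqrtr ?hs_ge0//; apply: (le_trans (inner_le _ _)).
  apply: (@le_trans _ _ (M * sqn eta * sqn eta)).
    by rewrite ler_wpM2r ?sqn_ge0 ?op_bounded.
  rewrite -mulrA -[leRHS]mulr1 ler_wpM2l ?hs_ge0//.
  by rewrite mulr_ile1 ?sqn_ge0.
have /choice[eta heta] n : exists eta, N eta /\
    sup A - n.+1%:R^-1 < normc (inner (x eta) eta).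
  have n0 : 0 < n.+1%:R^-1 :> R by rewrite invr_gt0.
  by have [_ [eta Neta <-] h] := sup_adherent n0 hA; exists eta.
have [F [FU Foo]] := ultraFilterLemma (eventually_filter : ProperFilter \oo).
have FP := ultra_proper; have FF : Filter F by exact: filter_filter.
have [xi xi1 wl] := weak_limit FU (fun n => (heta n).1.2).
pose z n := eta n - xi.
have z4 n : sqn (z n) <= 4.
  rewrite -nrm_sq (_ : 4 = 2 ^+ 2); last by ring.
  apply: lerXn2r; rewrite ?nnegrE ?nrm_ge0//.
  apply: (le_trans (nrmD _ _)).
  have n1 u : sqn u <= 1 -> nrm u <= 1 by move=> u1; rewrite /nrm -sqrtr1 ler_sqrt.
  rewrite [nrm (- xi)]/nrm sqnN.
  by have := n1 _ xi1; have := n1 _ (heta n).1.2; rewrite /nrm; lra.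
exists xi; split=> // [v Gv|zeta Gz z1].
  apply: eq0_normc; apply/eqP; rewrite eq_le normc_ge0 andbT.
  apply/ler_addgt0Pr => e e0; rewrite add0r.
  have /filter_ex[n] := weak_inner v FF z4 wl e0.
  by rewrite /z innerBl (heta n).1.1// sub0r normcN => /ltW.
suff h (e : R) : 0 < e ->
    normc (inner (x zeta) zeta) <= normc (inner (x xi) xi) + e.
  by apply/ler_addgt0Pr => e /h.
move=> e0; have e3 : 0 < e / 3 by rewrite divr_gt0.
have h1 := op_weak_strong FF z4 wl e3.
have h2 := weak_inner (x xi) FF z4 wl e3.
have h3 : \forall n \near F, n.+1%:R^-1 < e / 3 :> R.
  by apply: Foo; exact: (near_infty_natSinv_lt (PosNum e3)).
have [n [[hn1 hn2] hn3]] := filter_ex (filterI (filterI h1 h2) h3).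
have n1 : nrm (eta n) <= 1 by rewrite /nrm -sqrtr1 ler_sqrt// (heta n).1.2.
have : normc (inner (x zeta) zeta) <= sup A.
  by apply: ub_le_sup; [case: hA|exists zeta].
have := (heta n).2.
(* Since [eta n = xi + z n], the first correction is small because [x (z n)] tends to 0 in norm, the
   second because [z n] tends weakly to 0; the last third of [e] pays for the distance to
   [sup A]. *)
have -> : inner (x (eta n)) (eta n) =
    inner (x xi) xi + (inner (x (z n)) (eta n) + inner (x xi) (z n)).
  by rewrite /z raddfB !innerBl !innerBr; ring.
have := le_normcD (inner (x xi) xi) (inner (x (z n)) (eta n) + inner (x xi) (z n)).
have := le_normcD (inner (x (z n)) (eta n)) (inner (x xi) (z n)).
have : normc (inner (x (z n)) (eta n)) <= nrm (x (z n)).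
  apply: (le_trans (inner_le_nrm _ _)).
  by rewrite -[leRHS]mulr1 ler_wpM2l ?nrm_ge0.
have : normc (inner (x xi) (z n)) < e / 3 by rewrite inner_conj normc_conj.
move: hn1 hn3; move: (nrm _) (sup A) (normc (_ + (_ + _))) (normc (_ + _)).
move: (normc (inner (x (z n)) _)) (normc (inner (x zeta) _)) (normc (inner _ (z n))).
move: (normc _) (n.+1%:R^-1 : R) => a1 a2 a3 a4 a5 a6 a7 a8 a9.
lra.
Qed.

End NormalOperator.

(** * Vectors attaining the numerical radius are eigenvectors *)

Section Eigenvectors.
Variable R : realType.
Local Notation C := R[i].
Implicit Types (u v : l2 R).

Definition orth (G : set (l2 R)) : set (l2 R) :=
  [set u | forall v, G v -> inner u v = 0].

Lemma orth_lin G (a b : C) u v : orth G u -> orth G v ->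
  orth G (a *: u + b *: v).
Proof.
by move=> Gu Gv w Gw; rewrite innerDl !innerZl Gu// Gv// !mulr0 addr0.
Qed.

Section NumericalRadius.
Variables z zs : {linear l2 R -> l2 R}.
Hypothesis adj : adjoint_to z zs.
Hypothesis comm : z \o zs = zs \o z.
Variables (G : set (l2 R)) (W : R).
Hypothesis Gz : forall u, orth G u -> orth G (z u).
Hypothesis Gzs : forall u, orth G u -> orth G (zs u).
Hypothesis zW : forall u, orth G u -> normc (inner (z u) u) <= W * sqn u.

Let gap u := W * sqn u - complex.Re (inner (z u) u).

Let gap_ge0 u : orth G u -> 0 <= gap u.
Proof.
move=> Gu; rewrite subr_ge0; apply: le_trans (zW Gu).
exact: le_trans (ler_norm _) (normc_Re _).
Qed.

(* A zero of the nonnegative quadratic form [gap] is a critical point. *)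
Let gap_critical u : orth G u -> gap u = 0 ->
  z u + zs u = (2 * W)%:C *: u.
Proof.
move=> Gu gu; apply/eqP; rewrite eq_sym -subr_eq0; apply/eqP/sqn_eq0.
have [g gE] : exists g, g = (2 * W)%:C *: u - (z u + zs u) by eexists.
rewrite -gE; have Gg : orth G g.
  rewrite gE -[X in _ - X]scale1r -scaleNr; apply: orth_lin => //.
  rewrite -[z u]scale1r -[zs u]scale1r; apply: orth_lin; [exact: Gz|exact: Gzs].
(* [g] is the gradient of [gap] at [u], so the linear coefficient along it is [sqn g]; the constant
   term is [gap u = 0]. *)
have gt (t : R) : gap (u + t%:C *: g) = t * sqn g + t ^+ 2 * gap g.
  have -> : sqn g = 2 * W * complex.Re (inner u g) -
      complex.Re (inner (z u) g) - complex.Re (inner (z g) u).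
    rewrite {1}/sqn {1}gE innerBl innerDl innerZl (adj g u) (inner_conj (zs u) g).
    case: (inner (z u) g) (inner (zs u) g) (inner u g) => [a b] [c d] [e f] /=.
    by ring.
  have -> : gap (u + t%:C *: g) = gap u + (t * (2 * W * complex.Re (inner u g) -
      complex.Re (inner (z u) g) - complex.Re (inner (z g) u)) + t ^+ 2 * gap g).
    rewrite /gap sqnD sqnZ normc_real real_normK ?num_real//.
    have -> : z (u + t%:C *: g) = z u + t%:C *: z g by rewrite linearD linearZ.
    rewrite innerDl !innerDr !innerZl !innerZr conjc_real.
    case: (inner (z u) g) (inner (z g) u) (inner u g) (inner (z u) u)
      (inner (z g) g) => [a b] [c d] [e f] [p q] [r s] /=.
    by ring.
  by rewrite gu add0r.
have pos t : 0 <= t * sqn g + t ^+ 2 * gap g.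
  rewrite -gt; apply: gap_ge0; rewrite -[u]scale1r; exact: orth_lin.
have g0 := gap_ge0 Gg; have s0 := sqn_ge0 g.
(* A negative [t] small enough for the linear term to win; the [+ 1] keeps the denominator positive
   when [gap g = 0]. *)
have := pos (- (sqn g / (2 * (gap g + 1)))).
move: (sqn g) (gap g) g0 s0 => s p p0 s0.
rewrite (_ : _ + _ = - (s ^+ 2 * (p + 2) / (4 * (p + 1) ^+ 2))); last first.
  by field; rewrite gt_eqF//; lra.
rewrite oppr_ge0 => h; apply/eqP; rewrite -sqrf_eq0 eq_le sqr_ge0 andbT.
have q0 : 0 < (p + 2) / (4 * (p + 1) ^+ 2).
  by rewrite divr_gt0 ?mulr_gt0 ?exprn_gt0//; lra.
by move: h; rewrite -mulrA pmulr_lle0.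
Qed.

(** Pairing the hypothesis with [u] shows that the real part of [inner (z u) u] is [W * sqn u],
    already the largest modulus allowed by [zW], so the imaginary part vanishes. *)
Let form_real u : orth G u -> z u + zs u = (2 * W)%:C *: u ->
  inner (z u - W%:C *: u) u = 0.
Proof.
move=> Gu zu.
have : inner (z u) u + (inner (z u) u)^*%C = (2 * W * sqn u)%:C.
  by rewrite -inner_conj -(adjC adj) -innerDl zu innerZl inner_self -rmorphM.
rewrite innerBl innerZl inner_self -rmorphM /=.
have := zW Gu; move: (sqn_ge0 u); case: (inner (z u) u) => a b s0.
have W0 : 0 <= W * sqn u by apply: le_trans (zW Gu); exact: normc_ge0.
rewrite -(ler_pXn2r (n := 2)) ?nnegrE ?normc_ge0// normc_sqE /=.
move=> h /eqP; rewrite eq_complex /= => /andP[/eqP aE _].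
have {}aE : a = W * sqn u by lra.
have : b ^+ 2 <= 0 by move: h; rewrite aE; lra.
rewrite aE => b0; apply/eqP; rewrite eq_complex /= subrr eqxx subr0.
by rewrite -sqrf_eq0 eq_le b0 sqr_ge0.
Qed.

(* Put k = z u - W u.  Both u and k lie in the eigenspace of z + zs for 2W, where
   the form of z - W vanishes; evaluating it at u + k and u + i k gives k = 0. *)
Lemma numerical_radius_eigen u : orth G u -> inner (z u) u = (W * sqn u)%:C ->
  z u = W%:C *: u.
Proof.
move=> Gu zu; have Hu : z u + zs u = (2 * W)%:C *: u.
  by apply: gap_critical; rewrite // /gap zu subrr.
apply/eqP; rewrite -subr_eq0; apply/eqP.
have [k kE] : exists k, k = z u - W%:C *: u by eexists.
rewrite -kE; have Gk : orth G k.
  by rewrite kE -[z u]scale1r -scaleNr; apply: orth_lin => //; exact: Gz.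
(* [z] commutes with [z + zs], hence preserves its eigenspaces. *)
have Hk : z k + zs k = (2 * W)%:C *: k.
  have -> : z k + zs k = z (z u + zs u) - W%:C *: (z u + zs u).
    have -> : z k = z (z u) - W%:C *: z u by rewrite kE linearB linearZ.
    have -> : zs k = z (zs u) - W%:C *: zs u.
      by rewrite kE linearB linearZ (commE comm).
    by rewrite linearD scalerDr opprD addrACA.
  by rewrite Hu linearZ /= kE scalerBr !scalerA [W%:C * _]mulrC.
have Lk (c : C) : inner (z (u + c *: k) - W%:C *: (u + c *: k)) (u + c *: k) = 0.
  apply: form_real; first by rewrite -[u]scale1r; exact: orth_lin.
  have zD (f : {linear l2 R -> l2 R}) : f (u + c *: k) = f u + c *: f k.
    by rewrite linearD linearZ.
  rewrite (zD z) (zD zs) addrACA Hu -scalerDr Hk scalerDr.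
  by rewrite !scalerA [c * _]mulrC.
have uE : inner k u = 0 by rewrite kE; exact: form_real.
have Lk0 : inner (z k - W%:C *: k) k = 0 by exact: form_real.
have LE (c : C) : c^*%C * inner k k + c * inner (z k - W%:C *: k) u = 0.
  have := Lk c.
  have -> : z (u + c *: k) - W%:C *: (u + c *: k) = k + c *: (z k - W%:C *: k).
    rewrite linearD linearZ scalerDr opprD addrACA scalerBr -kE.
    by rewrite !scalerA [c * _]mulrC.
  rewrite innerDl !innerDr !innerZl !innerZr uE Lk0 => <-.
  by rewrite !mulr0 add0r addr0.
have := LE 1; have := LE 'i%C; rewrite conjc1 !mul1r.
rewrite (_ : ('i%C)^*%C = - 'i%C :> C); last first.
  by apply/eqP; rewrite eq_complex /= ?oppr0 !eqxx.
rewrite mulNr addrC => /eqP; rewrite subr_eq0 => /eqP/mulfI -> //.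
  move=> /eqP; rewrite -mulr2n mulrn_eq0/= inner_self => /eqP [/sqn_eq0].
  by [].
by rewrite eq_complex /= negb_and oner_eq0 orbT.
Qed.

End NumericalRadius.
End Eigenvectors.

(** * Eigenspaces and eigenvalues of a normal Hilbert-Schmidt operator *)

Section SpectralTheory.
Variable R : realType.
Local Notation C := R[i].
Implicit Types (u v : l2 R).
Variables x xs : {linear l2 R -> l2 R}.
Hypothesis adj : adjoint_to x xs.
Hypothesis comm : x \o xs = xs \o x.
Variable M : R.
Hypothesis hs : forall n, \sum_(j < n) sqn (x (delta R j)) <= M.

(** For a maximizer [u] of the form, a unimodular [c] turns [inner (x u) u] into its modulus [W];
    [numerical_radius_eigen] for [c \*: x] then gives the eigenvalue [W / c]. *)
Lemma exists_eigenvector (G : set (l2 R)) :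
  (forall u, orth G u -> orth G (x u)) ->
  (forall u, orth G u -> orth G (xs u)) ->
  (exists2 u, orth G u & inner (x u) u != 0) ->
  exists (l : C) u, [/\ l != 0, u != 0, orth G u & x u = l *: u].
Proof.
move=> Gx Gxs [eta Geta eta0].
have [u [Gu u1 umax]] := form_max adj comm hs G.
pose w := inner (x u) u; pose W : R := normc w.
have W0 : 0 <= W by exact: normc_ge0.
have homog v : orth G v -> normc (inner (x v) v) <= W * sqn v.
  move=> Gv; have [/sqn_eq0 ->|v0] := eqVneq (sqn v) 0.
    by rewrite inner0r normc0 sqn0 mulr0.
  have vp : 0 < sqn v by rewrite lt_neqAle eq_sym v0 sqn_ge0.
  have nv : 0 < nrm v by rewrite sqrtr_gt0.
  have Gv' : orth G ((nrm v)^-1%:C *: v).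
    by move=> k Gk; rewrite innerZl Gv ?mulr0.
  have := umax _ Gv'; rewrite (_ : x (_ *: v) = (nrm v)^-1%:C *: x v) ?linearZ//.
  rewrite sqnZ innerZl innerZr !normcM.
  rewrite normc_conj normc_real gtr0_norm ?invr_gt0// exprVn nrm_sq mulVf//.
  by move=> /(_ (lexx _)); rewrite mulrA -invfM -expr2 nrm_sq ler_pdivrMl// mulrC.
have Wp : 0 < W.
  rewrite lt_neqAle W0 andbT eq_sym; apply/eqP => W00.
  move: (homog _ Geta); rewrite W00 mul0r => h.
  by move/eqP: eta0; apply; apply: eq0_normc; apply/eqP; rewrite eq_le h normc_ge0.
have su : sqn u = 1.
  apply/eqP; rewrite eq_le u1 /=; have := homog _ Gu.
  by rewrite -/w -/W -[leLHS]mulr1 ler_pM2l.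
have W0' : W%:C != 0 by rewrite eq_complex /= eqxx andbT gt_eqF.
pose c : C := w^*%C / W%:C.
have cw : c * w = W%:C.
  rewrite /c mulrAC [_ * w]mulrC mul_conjc rmorphXn /= -/W expr2 mulfK//.
have nc : normc c = 1.
  have := congr1 (fun t : C => normc t) cw; rewrite normcM normc_real gtr0_norm// -/W.
  by rewrite -[X in _ = X]mul1r => /mulIf; apply; rewrite gt_eqF.
pose z : {linear l2 R -> l2 R} := c \*: x.
pose zs : {linear l2 R -> l2 R} := c^*%C \*: xs.
have zE v : z v = c *: x v by [].
have zsE v : zs v = c^*%C *: xs v by [].
have zadj : adjoint_to z zs.
  by move=> v v'; rewrite zE zsE innerZl innerZr conjcK adj.
have zcomm : z \o zs = zs \o z.
  apply/funext => v; rewrite -[LHS]/(c *: x (c^*%C *: xs v)).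
  rewrite -[RHS]/(c^*%C *: xs (c *: x v)) [x (_ *: _)]linearZ [xs (_ *: _)]linearZ.
  by rewrite /= (commE comm) !scalerA mulrC.
have zu : z u = W%:C *: u.
  apply: (@numerical_radius_eigen _ z zs zadj zcomm G W).
  - by move=> v /Gx Gv k Gk; rewrite zE innerZl Gv ?mulr0.
  - by move=> v /Gxs Gv k Gk; rewrite zsE innerZl Gv ?mulr0.
  - by move=> v /homog; rewrite zE innerZl normcM nc mul1r.
  - exact: Gu.
  - by rewrite zE innerZl -/w cw su mulr1.
have c0 : c != 0.
  by apply/eqP => c0; move: nc; rewrite c0 normc0 => /eqP; rewrite eq_sym oner_eq0.
exists (c^-1 * W%:C), u; split=> //.
- by rewrite mulf_neq0// invr_neq0.
- by apply/eqP => u0; move: su; rewrite u0 sqn0 => /eqP; rewrite eq_sym oner_eq0.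
- by rewrite -scalerA -zu zE scalerA mulVf// scale1r.
Qed.

Definition eigvecs : set (l2 R) := [set u | exists2 l : C, l != 0 & x u = l *: u].

Lemma orth_eigvecs_op u : orth eigvecs u -> orth eigvecs (x u).
Proof.
move=> Gu v [l l0 xv]; rewrite adj (eigen_adj adj comm xv) innerZr Gu ?mulr0//.
by exists l.
Qed.

Lemma orth_eigvecs_adj u : orth eigvecs u -> orth eigvecs (xs u).
Proof.
move=> Gu v [l l0 xv]; rewrite (adjC adj) xv innerZr Gu ?mulr0//.
by exists l.
Qed.

(** A nonzero value of the form on the complement would yield there an eigenvector with nonzero
    eigenvalue, hence orthogonal to itself. Once the form vanishes, polarization along
    [u + c *: x u] kills [x u]. *)
Lemma orth_eigvecs_ker u : orth eigvecs u -> x u = 0.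
Proof.
have form0 v : orth eigvecs v -> inner (x v) v = 0.
  move=> Gv; apply: contrapT => /eqP v0.
  have [l [w [l0 w0 Gw xw]]] := exists_eigenvector orth_eigvecs_op
    orth_eigvecs_adj (ex_intro2 _ _ v Gv v0).
  move/eqP: w0; apply; apply: sqn_eq0.
  by rewrite /sqn Gw//; exists l.
move=> Gu; set v := x u; have Gv : orth eigvecs v by exact: orth_eigvecs_op.
have polar (c : C) : c^*%C * inner v v + c * inner (x v) u = 0.
  have := form0 (u + c *: v).
  rewrite linearD linearZ innerDl !innerDr !innerZl !innerZr !form0//.
  rewrite !mulr0 add0r addr0; apply.
  by rewrite -[u]scale1r; exact: orth_lin.
(* [c = 1] makes the two terms opposite and [c = i] makes them equal, so [inner v v = 0]. *)
apply: sqn_eq0; have := polar 1; have := polar 'i; rewrite conjc1 !mul1r.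
rewrite (_ : 'i^*%C = - 'i :> C); last first.
  by apply/eqP; rewrite eq_complex /= ?oppr0 !eqxx.
rewrite mulNr addrC => /eqP; rewrite subr_eq0 => /eqP/mulfI -> //.
  by move=> /eqP; rewrite -mulr2n mulrn_eq0/= inner_self => /eqP [].
by rewrite eq_complex /= negb_and oner_eq0 orbT.
Qed.

Definition onfam (l : C) n := exists e : 'I_n -> l2 R,
  (forall k, x (e k) = l *: e k) /\
  forall j k, inner (e j) (e k) = (j == k)%:R.

Lemma onfam_bound (l : C) : l != 0 ->
  exists m, forall n, onfam l n -> (n <= m)%N.
Proof.
move=> l0; have lp : 0 < normc l ^+ 2.
  rewrite exprn_gt0// lt_neqAle normc_ge0 andbT eq_sym.
  by apply: contra_neq l0; exact: eq0_normc.
exists (Num.bound (M / normc l ^+ 2)) => n [e [xe oe]].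
have := hs_orthonormal adj comm hs oe.
under eq_bigr => k _ do rewrite xe sqnZ /sqn oe eqxx mulr1.
rewrite sumr_const card_ord -mulr_natl -ler_pdivlMr// => h.
have M0 := hs_ge0 hs.
have := archi_boundP (divr_ge0 M0 (ltW lp)) => /(le_lt_trans h).
by rewrite ltr_nat => /ltnW.
Qed.

Lemma onfam_extend (l : C) n (e : 'I_n -> l2 R) r :
  (forall k, x (e k) = l *: e k) ->
  (forall j k, inner (e j) (e k) = (j == k)%:R) ->
  x r = l *: r -> (forall k, inner r (e k) = 0) -> r != 0 -> onfam l n.+1.
Proof.
move=> xe oe xr re r0; pose r' := (nrm r)^-1%:C *: r.
have r'e k : inner r' (e k) = 0 by rewrite innerZl re mulr0.
have r'r' : inner r' r' = 1.
  rewrite inner_self sqnZ normc_real ger0_norm ?invr_ge0 ?nrm_ge0// exprVn nrm_sq.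
  by rewrite mulVf//; apply: contra_neq r0; exact: sqn_eq0.
exists (fun k => if unlift ord_max k is Some j then e j else r'); split.
  move=> k; case: unliftP => [j _|_]; first exact: xe.
  by rewrite linearZ /= xr !scalerA mulrC.
move=> j k; case: unliftP => [j' ->|->]; case: unliftP => [k' ->|->].
- by rewrite oe (inj_eq lift_inj).
- by rewrite inner_conj r'e conjc0 eq_sym (negbTE (neq_lift _ _)).
- by rewrite r'e (negbTE (neq_lift _ _)).
- by rewrite r'r' eqxx.
Qed.

(** By [onfam_bound] there is an orthonormal family of eigenvectors of maximal size; it spans the
    eigenspace, since a nonzero remainder [v - P v] would extend it. *)
Lemma orthoproj_eigenspace (l : C) : l != 0 ->
  exists P, is_orthoproj (Defs.eigenspace x l) P.
Proof.
move=> l0; have [m hm] := onfam_bound l0.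
have ex : exists n, `[< onfam l n >].
  by exists 0%N; apply/asboolP; exists (fun=> 0); split=> -[].
have ub n : `[< onfam l n >] -> (n <= m)%N by move=> /asboolP; exact: hm.
have [n /asboolP[e [xe oe]] nmax] := ex_maxnP ex ub.
pose P u := \sum_k inner u (e k) *: e k.
have Pe u k : inner (P u) (e k) = inner u (e k).
  rewrite inner_suml (bigD1 k)//= big1 => [|j jk].
    by rewrite addr0 innerZl oe eqxx mulr1.
  by rewrite innerZl oe (negbTE jk) mulr0.
have EP u : x (P u) = l *: P u.
  rewrite linear_sum scaler_sumr; apply: eq_bigr => k _.
  by rewrite linearZ /= xe !scalerA mulrC.
exists P => u; split=> [|v xv]; first exact: EP.
have -> : v = P v.
  apply/eqP; rewrite -subr_eq0; apply/negPn/negP => r0.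
  have : onfam l n.+1.
    apply: (onfam_extend xe oe _ _ r0); first by rewrite linearB EP xv scalerBr.
    by move=> k; rewrite innerBl Pe subrr.
  by move=> /asboolP/nmax; rewrite ltnn.
rewrite inner_sumr big1// => k _.
by rewrite innerZr innerBl Pe subrr mulr0.
Qed.

(** Unit eigenvectors for distinct eigenvalues are orthonormal, so [N] eigenvalues of modulus at
    least [e] force [N e^2 <= M]. *)
Lemma eigenvalues_finite (e : R) : 0 < e ->
  finite_set [set l | eigenvalues x l /\ e <= normc l].
Proof.
move=> e0; apply: contrapT => inf; have M0 := hs_ge0 hs.
have e2 : 0 < e ^+ 2 by exact: exprn_gt0.
pose N := Num.bound (M / e ^+ 2).
have [B BA NB] := infinite_set_fset N inf.
have /choice[w hw] (l : C) : exists u, eigenvalues x l ->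
    sqn u = 1 /\ x u = l *: u.
  have [[u [u0 xu]]|nl] := pselect (eigenvalues x l); last by exists 0.
  exists ((nrm u)^-1%:C *: u) => _; split.
    rewrite sqnZ normc_real ger0_norm ?invr_ge0 ?nrm_ge0// exprVn nrm_sq.
    by rewrite mulVf//; apply: contra_neq u0; exact: sqn_eq0.
  by rewrite linearZ /= xu !scalerA mulrC.
pose s : seq C := finmap.enum_fset B.
have sA (k : 'I_N) : eigenvalues x s`_k /\ e <= normc s`_k.
  by apply: BA; rewrite /=; apply: mem_nth; apply: leq_trans NB.
have := @hs_orthonormal _ _ _ adj comm M hs N (fun k => w s`_k).
have oe (j k : 'I_N) : inner (w s`_j) (w s`_k) = (j == k)%:R.
  have [[_ wj] [wk xk]] := ((hw _ (sA j).1), (hw _ (sA k).1)).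
  have [->|jk] := eqVneq j k; first by rewrite inner_self wk.
  apply: (eigen_orth adj comm _ wj xk).
  rewrite nth_uniq ?finmap.fset_uniq// (leq_trans _ NB)//.
move=> /(_ oe); apply/negP; rewrite -ltNge.
apply: (@lt_le_trans _ _ (N%:R * e ^+ 2)).
  rewrite -ltr_pdivrMr//; apply: archi_boundP; exact: divr_ge0 (ltW e2).
rewrite mulr_natl -[X in _ *+ X]card_ord -sumr_const; apply: ler_sum => k _.
have [wk xk] := hw _ (sA k).1.
rewrite xk sqnZ wk mulr1; apply: lerXn2r; rewrite ?nnegrE ?normc_ge0 ?(ltW e0)//.
exact: (sA k).2.
Qed.

(** The indices are the codes of the eigenvalues under an injection into [nat], so [I] may be finite
    or have gaps; the last clause is convergence of [lam] to 0 along [I]. *)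
Lemma eigenvalues_enum : exists (I : set nat) (lam : nat -> C),
  [/\ set_inj I lam, lam @` I = eigenvalues x `\ 0 &
   forall e : R, 0 < e ->
     exists N, forall k, (N <= k)%N -> I k -> normc (lam k) < e].
Proof.
pose L := eigenvalues x `\ (0 : C).
have /countable_injP[f fI] : countable L.
  have -> : L = \bigcup_n
      [set l | L l /\ n.+1%:R^-1 <= normc l].
    rewrite eqEsubset; split=> [l [xl /eqP l0]|l [n _ []]//].
    have lp : 0 < normc l.
      rewrite lt_neqAle normc_ge0 andbT eq_sym.
      by apply: contra_neq l0; exact: eq0_normc.
    exists (Num.bound (normc l)^-1) => //; split; first by split=> //; exact/eqP.
    rewrite invf_ple ?posrE//; apply: ltW.
    apply: lt_trans (archi_boundP _) _; first by rewrite invr_ge0 ltW.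
    by rewrite ltr_nat.
  apply: bigcup_countable => // n _; apply: finite_set_countable.
  apply: sub_finite_set (@eigenvalues_finite n.+1%:R^-1 _); last first.
    by rewrite invr_gt0.
  by move=> l [[]].
pose lam n := xget (0 : C) [set l | L l /\ f l = n].
have lamf l : L l -> lam (f l) = l.
  move=> Ll; rewrite /lam; case: xgetP => [l' _ [Ll' /fI]|/(_ l)[]//].
  by apply; rewrite inE.
exists (f @` L), lam; split.
- move=> _ _ /set_mem[l Ll <-] /set_mem[l' Ll' <-].
  by rewrite !lamf// => ->.
- rewrite eqEsubset; split=> [_ [_ [l Ll <-] <-]|l Ll]; first by rewrite lamf.
  by exists (f l); [exists l|exact: lamf].
- move=> e e0; have /finite_seqP[s sE] := eigenvalues_finite e0.
  exists (\max_(l <- s) (f l).+1) => k Nk [l Ll lk]; rewrite -lk lamf//.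
  rewrite ltNge; apply/negP => el.
  have ls : l \in s.
    have : [set` s] l by rewrite -sE; split=> //; exact: Ll.1.
    by [].
  have := @leq_bigmax_seq _ s xpredT (fun l => (f l).+1) l ls isT.
  by rewrite lk => /leq_trans/(_ Nk); rewrite ltnn.
Qed.

End SpectralTheory.

(** * Functional calculus *)

Section Inequalities.
Variable R : realType.

(** For [l <= b] the first term suffices; for [l > b] the second, because [t - 2 <= 0] makes
    [l^(t-2) <= b^(t-2)]. *)
Lemma powR_young (l b t : R) : 0 <= l -> 0 < b -> 0 < t <= 2 ->
  l `^ t <= b `^ t + b `^ (t - 2) * l ^+ 2.
Proof.
move=> l0 b0 /andP[t0 t2]; have [lb|bl] := leP l b.
  apply: (@le_trans _ _ (b `^ t)).
    by apply: ge0_ler_powR; rewrite ?nnegrE// ltW.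
  by rewrite lerDl mulr_ge0 ?powR_ge0 ?sqr_ge0.
have lp : 0 < l by exact: lt_trans bl.
apply: (@le_trans _ _ (b `^ (t - 2) * l ^+ 2)); last by rewrite lerDr powR_ge0.
have -> : l `^ t = l `^ (t - 2) * l ^+ 2.
  by rewrite -[l ^+ 2](powR_mulrn 2 l0) -powRD ?subrK// (gt_eqF lp) implybT.
rewrite ler_wpM2r ?sqr_ge0// -opprB !powRN lef_pV2 ?posrE ?powR_gt0//.
by apply: ge0_ler_powR; rewrite ?nnegrE ?subr_ge0// ltW.
Qed.

Lemma weighted_cauchy_schwarz (I : finType) (Q : pred I) (w p q : I -> R) (A B : R) :
  (forall k, Q k -> 0 <= w k) ->
  \sum_(k | Q k) w k * p k ^+ 2 <= A -> \sum_(k | Q k) w k * q k ^+ 2 <= B ->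
  \sum_(k | Q k) w k * (p k * q k) <= Num.sqrt A * Num.sqrt B.
Proof.
move=> w0 pA qB; set S := \sum_(k | Q k) _ * (_ * _).
have A0 : 0 <= A.
  by apply: le_trans pA; apply: sumr_ge0 => k Qk; rewrite mulr_ge0 ?w0 ?sqr_ge0.
have B0 : 0 <= B.
  by apply: le_trans qB; apply: sumr_ge0 => k Qk; rewrite mulr_ge0 ?w0 ?sqr_ge0.
have pos (s : R) : 0 <= s ^+ 2 * A - 2 * s * S + B.
  have : 0 <= \sum_(k | Q k) w k * (s * p k - q k) ^+ 2.
    by apply: sumr_ge0 => k Qk; rewrite mulr_ge0 ?w0 ?sqr_ge0.
  have -> : \sum_(k | Q k) w k * (s * p k - q k) ^+ 2 =
      s ^+ 2 * (\sum_(k | Q k) w k * p k ^+ 2) - 2 * s * S +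
      \sum_(k | Q k) w k * q k ^+ 2.
    rewrite !mulr_sumr -sumrB -big_split; apply: eq_bigr => k _ /=; ring.
  move=> h; apply: (le_trans h); apply: lerD => //.
  by rewrite lerD2r ler_wpM2l ?sqr_ge0.
have [S0|S0] := leP S 0.
  by apply: (le_trans S0); rewrite mulr_ge0 ?sqrtr_ge0.
rewrite -(ler_pXn2r (n := 2)) ?nnegrE ?mulr_ge0 ?sqrtr_ge0 ?(ltW S0)//.
rewrite exprMn !sqr_sqrtr//.
(* For [A = 0] the polynomial in [pos] is affine and equals -1 at [(B + 1) / (2 S)]; otherwise its
   minimum, at [S / A], gives the claim. *)
have [A00|An0] := eqVneq A 0.
  have := pos ((B + 1) / (2 * S)); rewrite A00 mulr0 add0r.
  rewrite (_ : 2 * _ * S = B + 1); last by field; rewrite gt_eqF.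
  lra.
have := pos (S / A); have Ap : 0 < A by rewrite lt_neqAle eq_sym An0.
rewrite (_ : _ + B = (A * B - S ^+ 2) / A); last by field.
by rewrite pmulr_lge0 ?invr_gt0// subr_ge0.
Qed.

Lemma rapid_sqrt_powR (b : nat -> R) (t : R) : (forall j, 0 <= b j) ->
  0 < t -> rapid b -> rapid (fun j => Num.sqrt (2 * b j `^ t)).
Proof.
move=> b0 t0 rb r.
(* The power [t] and the square root turn decay of order [r'] into order [r' t / 2], which this
   choice makes at least [r]. *)
pose r' := Num.bound (2 * r%:R / t); have [K bK] := rb r'.
have rt : (2 * r)%:R <= r'%:R * t.
  rewrite -ler_pdivrMr// natrM ltW//; apply: archi_boundP.
  by rewrite divr_ge0 ?mulr_ge0// ltW.
exists (Num.sqrt (2 * K `^ t)) => j.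
rewrite -[X in _ * X]ger0_norm ?exprn_ge0// -sqrtr_sqr -sqrtrM ?mulr_ge0 ?powR_ge0//.
rewrite ler_sqrt ?mulr_ge0 ?powR_ge0// -mulrA ler_wpM2l//.
apply: (@le_trans _ _ ((b j * j.+1%:R ^+ r') `^ t)); last first.
  apply: ge0_ler_powR; rewrite ?nnegrE ?mulr_ge0 ?exprn_ge0 ?(ltW t0)//.
  by apply: le_trans (bK j); rewrite mulr_ge0 ?exprn_ge0.
rewrite powRM ?exprn_ge0// ler_wpM2l ?powR_ge0//.
rewrite -exprM -!powR_mulrn// -powRrM; apply: ler_powR; first by rewrite ler1n.
by rewrite mulnC.
Qed.

End Inequalities.

(** * Orthogonal projections onto the eigenspaces *)

Section Projections.
Variable R : realType.
Local Notation C := R[i].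
Implicit Types (u v : l2 R).
Variables x xs : {linear l2 R -> l2 R}.
Hypothesis adj : adjoint_to x xs.
Hypothesis comm : x \o xs = xs \o x.
Variables (I : set nat) (lam : nat -> C) (P : nat -> l2 R -> l2 R).
Hypothesis lam_inj : set_inj I lam.
Hypothesis projP : forall k, I k -> is_orthoproj (Defs.eigenspace x (lam k)) (P k).

Lemma proj_inner k u v : I k -> inner u (P k v) = inner (P k u) (P k v).
Proof.
move=> Ik; apply/eqP; rewrite -subr_eq0 -innerBl; apply/eqP.
by apply: (projP Ik u).2; exact: (projP Ik v).1.
Qed.

Lemma proj_adj k u v : I k -> inner (P k u) v = inner u (P k v).
Proof.
by move=> Ik; rewrite inner_conj (proj_inner v u Ik) -inner_conj (proj_inner u v Ik).
Qed.

Lemma proj_self k u : I k -> inner u (P k u) = (sqn (P k u))%:C.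
Proof. by move=> Ik; rewrite (proj_inner u u Ik) inner_self. Qed.

Lemma proj_orth j k u v : I j -> I k -> j != k -> inner (P j u) (P k v) = 0.
Proof.
move=> Ij Ik jk; apply: (@eigen_orth _ x xs adj comm (lam j) (lam k)).
- by apply: contra_neq jk => /lam_inj; apply; rewrite inE.
- exact: (projP Ij u).1.
- exact: (projP Ik v).1.
Qed.

Lemma proj_op k u : I k -> P k (x u) = lam k *: P k u.
Proof.
move=> Ik; apply/eqP; rewrite -subr_eq0; apply/eqP/sqn_eq0; apply: complexI.
have [xPu Pu] := projP Ik u; have [xPxu Pxu] := projP Ik (x u).
set w := _ - _; have xw : x w = lam k *: w.
  by rewrite /w linearB linearZ /= xPu xPxu scalerBr.
have e1 : inner (P k (x u)) w = inner (x u) w.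
  by apply/esym/eqP; rewrite -subr_eq0 -innerBl Pxu.
have e2 : inner (P k u) w = inner u w.
  by apply/esym/eqP; rewrite -subr_eq0 -innerBl Pu.
rewrite -inner_self {1}/w innerBl innerZl e1 e2 adj (eigen_adj adj comm xw).
by rewrite innerZr conjcK subrr.
Qed.

Lemma proj_bessel n (Q : pred 'I_n) u : (forall k, Q k -> I k) ->
  \sum_(k | Q k) sqn (P k u) <= sqn u.
Proof.
move=> QI; apply: bessel => [j k Qj Qk jk|k Qk]; last exact: proj_self (QI _ Qk).
by apply: proj_orth; [exact: QI|exact: QI|].
Qed.

(* Replaces Hoelder's inequality: [l^t <= b^t + b^(t - 2) l^2] with b = |x u|, and
   the weights l^2 turn the projections of u into those of x u. *)
Lemma weighted_bessel n (Q : pred 'I_n) (t : R) u : (forall k, Q k -> I k) ->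
  0 < t <= 2 -> sqn u <= 1 ->
  \sum_(k | Q k) normc (lam k) `^ t * sqn (P k u) <= 2 * nrm (x u) `^ t.
Proof.
move=> QI t2 u1.
have sxu : \sum_(k | Q k) normc (lam k) ^+ 2 * sqn (P k u) <= nrm (x u) ^+ 2.
  rewrite nrm_sq; apply: le_trans (proj_bessel (x u) QI).
  by apply: ler_sum => k Qk; rewrite proj_op ?sqnZ//; exact: QI.

(* [powR_young] requires [b > 0]; for [x u = 0] every summand has [lam k = 0] or [P k u = 0]. *)
have [b0|bn0] := eqVneq (nrm (x u)) 0.
  rewrite big1 ?mulr_ge0 ?powR_ge0// => k Qk.
  have : normc (lam k) ^+ 2 * sqn (P k u) <= 0.
    rewrite -[leRHS](expr0n _ 2) -[in leRHS]b0; apply: le_trans sxu.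
    rewrite (bigD1 k)//= lerDl; apply: sumr_ge0 => j _.
    by rewrite mulr_ge0 ?sqr_ge0 ?sqn_ge0.
  move=> h; have /eqP : normc (lam k) ^+ 2 * sqn (P k u) = 0.
    by apply/eqP; rewrite eq_le h mulr_ge0 ?sqr_ge0 ?sqn_ge0.
  rewrite mulf_eq0 sqrf_eq0 => /orP[/eqP ->|/eqP ->]; last by rewrite mulr0.
  by rewrite powR0 ?mul0r// gt_eqF//; case/andP: t2.
have bp : 0 < nrm (x u) by rewrite lt_neqAle eq_sym bn0 nrm_ge0.
set b := nrm (x u) in bp sxu *.
apply: (@le_trans _ _ (\sum_(k | Q k)
    (b `^ t * sqn (P k u) + b `^ (t - 2) * (normc (lam k) ^+ 2 * sqn (P k u))))).
  apply: ler_sum => k _; rewrite mulrA -mulrDl ler_wpM2r ?sqn_ge0//.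
  by apply: powR_young; rewrite ?normc_ge0.
rewrite big_split /= -!mulr_sumr mulr_natl mulr2n; apply: lerD.
  rewrite -[leRHS]mulr1 ler_wpM2l ?powR_ge0//.
  exact: le_trans (proj_bessel u QI) u1.
apply: (@le_trans _ _ (b `^ (t - 2) * b ^+ 2)).
  by rewrite ler_wpM2l ?powR_ge0.
by rewrite -(powR_mulrn 2 (ltW bp)) -powRD ?subrK// (gt_eqF bp) implybT.
Qed.

End Projections.

Lemma rapid_hilbert_schmidt (R : realType) (x : l2 R -> l2 R) :
  rapid (fun j => nrm (x (delta R j))) ->
  exists M, forall n, \sum_(j < n) sqn (x (delta R j)) <= M.
Proof.
move=> /(rapid_sq (fun j => nrm_ge0 _))/rapid_partial_sum[M _ hM].
by exists M => n; under eq_bigr do rewrite -nrm_sq.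
Qed.

(** * Operators with prescribed coefficients on the eigenspaces *)

Section FunctionalCalculus.
Variable R : realType.
Local Notation C := R[i].
Implicit Types (u v : l2 R).
Variables x xs : {linear l2 R -> l2 R}.
Hypothesis adj : adjoint_to x xs.
Hypothesis comm : x \o xs = xs \o x.
Hypothesis decay : rapid (fun j => nrm (x (delta R j))).
Variables (I : set nat) (lam : nat -> C) (P : nat -> l2 R -> l2 R).
Hypothesis lam_inj : set_inj I lam.
Hypothesis lam_neq0 : forall k, I k -> lam k != 0.
Hypothesis lam0 : forall e : R, 0 < e ->
  exists N, forall k, (N <= k)%N -> I k -> normc (lam k) < e.
Hypothesis projP : forall k, I k -> is_orthoproj (Defs.eigenspace x (lam k)) (P k).

Section Coefficients.
Variables (mu : nat -> C) (t : R).
Hypothesis t02 : 0 < t <= 2.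
Hypothesis mu_small : forall e : R, 0 < e -> exists N, forall k, (N <= k)%N ->
  I k -> normc (mu k) <= e * normc (lam k) `^ t.

(** Square root of the [weighted_bessel] bound for [delta R i], as produced by Cauchy-Schwarz over
    [k] with weights [|lam k|^t]. *)
Let a i := Num.sqrt (2 * nrm (x (delta R i)) `^ t).
(* Entry (i, j) of the k-th summand [mu k *: P k]. *)
Let cf i j k : C :=
  if k \in I then mu k * inner (P k (delta R j)) (delta R i) else 0.

Let a_ge0 i : 0 <= a i. Proof. exact: sqrtr_ge0. Qed.

Let a_rapid : rapid a.
Proof. by apply: rapid_sqrt_powR => // [j|]; [exact: nrm_ge0|case/andP: t02]. Qed.

(** With [m = 0] it bounds the entries of the limit matrix; with large [m] and small [c], the
    truncation error. *)
Let tail_bound (c : R) m n i j : 0 <= c ->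
  (forall k, (m <= k)%N -> I k -> normc (mu k) <= c * normc (lam k) `^ t) ->
  \sum_(m <= k < n) normc (cf i j k) <= c * (a i * a j).
Proof.
move=> c0 muc.
have -> : \sum_(m <= k < n) normc (cf i j k) =
    \sum_(k < n | ((k : nat) \in I) && (m <= k)%N)
      normc (mu k * inner (P k (delta R j)) (delta R i)).
  rewrite -(big_mkord (fun k => (k \in I) && (m <= k)%N)
    (fun k => normc (mu k * inner (P k (delta R j)) (delta R i)))).
  rewrite -big_nat_widenl// [RHS]big_mkcond; apply: eq_bigr => k _ /=.
  by rewrite /cf; case: ifP => // _; rewrite normc0.
pose Q (k : 'I_n) := ((k : nat) \in I) && (m <= k)%N.
have QI (k : 'I_n) : Q k -> I k by case/andP => /set_mem.
apply: (@le_trans _ _ (\sum_(k | Q k) c * (normc (lam k) `^ t *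
   (nrm (P k (delta R j)) * nrm (P k (delta R i)))))).
  apply: ler_sum => k Qk; rewrite normcM mulrA; have Ik := QI _ Qk.
  apply: ler_pM; rewrite ?normc_ge0//.
    by apply: muc => //; case/andP: Qk.
  by rewrite (proj_adj projP)// (proj_inner projP)//; exact: inner_le_nrm.
rewrite -mulr_sumr ler_wpM2l// mulrC.
have d1 i' : sqn (delta R i') <= 1 by rewrite -nrm_sq nrm_delta expr1n.
apply: weighted_cauchy_schwarz => [k _||]; first exact: powR_ge0.
  under eq_bigr do rewrite nrm_sq.
  exact: (weighted_bessel adj comm lam_inj projP QI).
under eq_bigr do rewrite nrm_sq.
exact: (weighted_bessel adj comm lam_inj projP QI).
Qed.

(** Beyond some index the constant 1 works; the finitely many earlier ratios are added to it. *)
Let coef_bound : exists2 c : R, 0 < c &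
  forall k, I k -> normc (mu k) <= c * normc (lam k) `^ t.
Proof.
have [N hN] := mu_small ltr01.
have lp k : I k -> 0 < normc (lam k) `^ t.
  move=> Ik; apply: powR_gt0; rewrite lt_neqAle normc_ge0 andbT eq_sym.
  by apply: contra_neq (lam_neq0 Ik); exact: eq0_normc.
pose F (k : nat) : R := normc (mu k) / normc (lam k) `^ t.
have F0 k : 0 <= F k by rewrite divr_ge0 ?normc_ge0 ?powR_ge0.
exists (1 + \sum_(k < N) F k); first by rewrite ltr_wpDr ?sumr_ge0.
move=> k Ik; have [Nk|kN] := leqP N k.
  apply: le_trans (hN _ Nk Ik) _.
  by rewrite ler_wpM2r ?powR_ge0// lerDl sumr_ge0.
rewrite -ler_pdivrMr ?lp// -/(F k) (bigD1 (Ordinal kN))//= addrCA lerDl.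
by rewrite addr_ge0 ?sumr_ge0.
Qed.

Let mat i j : C := csum (cf i j).

Let cf_summable i j : abs_summable (cf i j).
Proof.
have [c c0 hc] := coef_bound; exists (c * (a i * a j)) => n.
rewrite -(big_mkord xpredT (fun k => normc (cf i j k))).
by apply: tail_bound; [exact: ltW|move=> k _; exact: hc].
Qed.

Let mat_bound : exists2 c : R, 0 <= c &
  forall i j, normc (mat i j) <= (c * a i) * (c * a j).
Proof.
(* Half of [c] in the multiplicative sense goes to each index, to match the product shape required
   by [rapid_matrix_Ls's]. *)
have [c c0 hc] := coef_bound; exists (Num.sqrt c); first exact: sqrtr_ge0.
move=> i j; rewrite mulrACA -expr2 sqr_sqrtr ?(ltW c0)//.
apply: csum_le => n; rewrite -(big_mkord xpredT (fun k => normc (cf i j k))).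
by apply: tail_bound; [exact: ltW|move=> k _; exact: hc].
Qed.

Let row_in_l2 i : in_l2 ((fun j => (mat i j)^*%C) : cseq R).
Proof.
have [c c0 hc] := mat_bound.
have ca0 j : 0 <= c * a j by rewrite mulr_ge0.
have [M _ aM] := rapid_partial_sum (rapid_sq ca0 (rapidZ c0 a_rapid)).
apply/in_l2P; exists ((c * a i) ^+ 2 * M) => n.
apply: le_trans (ler_wpM2l (sqr_ge0 _) (aM n)); rewrite mulr_sumr.
apply: ler_sum => j _; rewrite normc_conj -exprMn.
by apply: lerXn2r; rewrite ?nnegrE ?normc_ge0 ?mulr_ge0.
Qed.

Let row i : l2 R := L2 (row_in_l2 i).

Let psum n u := \sum_(k < n | (k : nat) \in I) mu k *: P k u.

Let psum_coord n i j :
  \sum_(k < n) cf i j k = inner (psum n (delta R j)) (delta R i).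
Proof.
rewrite inner_suml [RHS]big_mkcond; apply: eq_bigr => k _.
by rewrite /cf innerZl; case: ifP.
Qed.

(** The adjoint of [psum n] at [delta R i]: a coordinate of [psum n u] becomes the pairing of [u]
    with a fixed vector, as [row i] does for the limit, and [u] enters the error only through
    Cauchy-Schwarz. *)
Let psum_adj n i := \sum_(k < n | (k : nat) \in I) (mu k)^*%C *: P k (delta R i).

Let psum_adjE n u i : inner (psum n u) (delta R i) = inner u (psum_adj n i).
Proof.
rewrite inner_suml inner_sumr; apply: eq_bigr => k /set_mem Ik.
by rewrite innerZl innerZr conjcK (proj_adj projP).
Qed.

Lemma fun_calc_op : exists y : {linear l2 R -> l2 R},
  in_Ls's y /\ op_sum I mu P y.
Proof.
have [c c0 hc] := mat_bound.
have ca0 j : 0 <= c * a j by rewrite mulr_ge0.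
have [y [Ly yE]] := rapid_matrix_Ls's ca0 (rapidZ c0 a_rapid) hc.
exists y; split=> // e e0.
have [M M0 aM] := rapid_partial_sum (rapid_sq a_ge0 a_rapid).
(* The error entries will be at most [(e / M) a_i a_j], so its Hilbert-Schmidt norm, which bounds
   the operator norm, is at most [(e / M) M = e]. *)
have eM0 : 0 < e / M by rewrite divr_gt0.
have [N hN] := mu_small eM0.
exists N => // n Nn u; rewrite /= in Nn.
rewrite !wnorm_nrm -EFinM lee_fin -/(psum n u).
rewrite -(ler_pXn2r (n := 2)) ?nnegrE ?mulr_ge0 ?nrm_ge0 ?(ltW e0)//.
rewrite exprMn !nrm_sq; apply/sqn_leP => m.
apply: (@le_trans _ _ (\sum_(i < m) (a i ^+ 2 * (sqn u * (e / M) ^+ 2 * M)))).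
  apply: ler_sum => i _; rewrite -inner_delta innerBl.
  have -> : inner (y u) (delta R i) = inner u (row i).
    rewrite inner_delta yE innerE; congr csum; apply/funext => j /=.
    by rewrite conjcK mulrC.
  rewrite psum_adjE -innerBr; apply: (le_trans (inner_le _ _)).
  rewrite [leRHS](_ : _ = sqn u * ((e / M) ^+ 2 * a i ^+ 2 * M)); last by ring.
  rewrite ler_wpM2l ?sqn_ge0//; apply/sqn_leP => l.
  apply: (@le_trans _ _ (\sum_(j < l) ((e / M) ^+ 2 * a i ^+ 2 * a j ^+ 2))).
    apply: ler_sum => j _; rewrite -!exprMn.
    have eM1 := ltW eM0.
    apply: lerXn2r; rewrite ?nnegrE ?normc_ge0 ?(mulr_ge0 (mulr_ge0 eM1 _))//.
    have -> : l2_val (psum_adj n i - row i) j =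
        (\sum_(k < n) cf i j k - mat i j)^*%C.
      rewrite rmorphB /= psum_coord psum_adjE -inner_conj inner_delta.
      by [].
    rewrite normc_conj normcB -mulrA; apply: csum_dist_le; first exact: cf_summable.
    move=> n' nn'; apply: (le_trans (normc_sum _ _ _)); apply: tail_bound.
      exact: ltW.
    by move=> k nk; apply: hN; exact: leq_trans nk.
  by rewrite -mulr_sumr ler_wpM2l// (mulr_ge0 (sqr_ge0 _) (sqr_ge0 _)).
rewrite -mulr_suml; apply: (@le_trans _ _ (M * (sqn u * (e / M) ^+ 2 * M))).
  by rewrite ler_wpM2r// (mulr_ge0 (mulr_ge0 (sqn_ge0 u) (sqr_ge0 _)) (ltW M0)).
rewrite le_eqVlt; apply/orP; left; apply/eqP; field.
by rewrite gt_eqF.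
Qed.

End Coefficients.

Lemma fun_calc_op_holder (mu : nat -> C) (theta c : R) (N : nat) :
  0 < theta <= 1 -> 0 < c ->
  (forall k, (N <= k)%N -> I k -> normc (mu k) <= c * normc (lam k) `^ theta) ->
  exists y : {linear l2 R -> l2 R}, in_Ls's y /\ op_sum I mu P y.
Proof.
move=> /andP[th0 th1] c0 muN; apply: (@fun_calc_op mu (theta / 2)).
  by apply/andP; split; lra.
move=> e e0; have th2 : 0 < theta / 2 by rewrite divr_gt0.
(* For [|lam k|] below this threshold, [c |lam k|^(theta/2) <= e]; the other factor
   [|lam k|^(theta/2)] is the weight. *)
have d0 : 0 < (e / c) `^ (theta / 2)^-1 by rewrite powR_gt0 ?divr_gt0.
have [N' hN'] := lam0 d0; exists (maxn N N') => k.
rewrite geq_max => /andP[Nk N'k] Ik; apply: (le_trans (muN _ Nk Ik)).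
have lp : 0 < normc (lam k).
  rewrite lt_neqAle normc_ge0 andbT eq_sym.
  by apply: contra_neq (lam_neq0 Ik); exact: eq0_normc.
rewrite [X in _ `^ X](splitr theta) powRD ?(gt_eqF lp) ?implybT//.
rewrite mulrA ler_wpM2r ?powR_ge0// mulrC -ler_pdivlMr//.
have := hN' _ N'k Ik => /ltW.
move=> /(ge0_ler_powR (ltW th2)); rewrite -powRrM mulVf ?gt_eqF//.
rewrite powRr1 ?divr_ge0 ?(ltW e0) ?(ltW c0)//; apply.
  by rewrite nnegrE normc_ge0.
by rewrite nnegrE powR_ge0.
Qed.

(** Tests the series against an eigenvector, where one summand survives, and against a vector
    orthogonal to all eigenvectors, where none does. *)
Lemma op_sum_inner (mu : nat -> C) (y : l2 R -> l2 R) u w (c : C) N :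
  op_sum I mu P y ->
  (forall n, (N <= n)%N ->
    inner (\sum_(k < n | (k : nat) \in I) mu k *: P k u) w = c) ->
  inner (y u) w = c.
Proof.
move=> yP yc; apply/eqP; rewrite -subr_eq0 -normr_eq0 normrcE.
suff h (e : R) : 0 < e -> normc (inner (y u) w - c) <= e * (nrm u * nrm w).
  suff -> : normc (inner (y u) w - c) = 0 by [].
  apply/eqP; rewrite eq_le normc_ge0 andbT; apply/ler_addgt0Pr => e e0.
  have p0 : 0 < nrm u * nrm w + 1 by rewrite ltr_wpDl ?mulr_ge0 ?nrm_ge0.
  apply: (le_trans (h (e / (nrm u * nrm w + 1)) _)); first exact: divr_gt0.
  rewrite add0r mulrAC -mulrA ger_pMr// ler_pdivrMr// mul1r lerDl//.
move=> /yP[n0 _ hn0].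
have := hn0 (maxn n0 N) (leq_maxl _ _) u.
rewrite -(yc _ (leq_maxr n0 N)) -innerBl -normcN -innerNl opprB.
rewrite !wnorm_nrm -EFinM lee_fin mulrA => h.
by apply: (le_trans (inner_le_nrm _ _)); rewrite ler_wpM2r ?nrm_ge0.
Qed.

Hypothesis lam_eig : lam @` I = eigenvalues x `\ 0.

(* The sum y exists by [fun_calc_op_holder]; the range of D = x - y is orthogonal
   to all eigenvectors with nonzero eigenvalue, hence killed by x and xs, so that
   <D u, D u> = <u, xs (D u)> - <y u, D u> = 0. *)
Lemma op_sum_eigenvalues : op_sum I lam P x.
Proof.
have [y [_ yP]] : exists y : {linear l2 R -> l2 R}, in_Ls's y /\ op_sum I lam P y.
  apply: (@fun_calc_op_holder lam 1 1 0) => // [|k _ _].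
    by rewrite ltr01 lexx.
  by rewrite mul1r powRr1 ?normc_ge0.
suff xy : x =1 y by move=> e /yP; apply: filterS => n h u; rewrite xy.
move=> u; apply/eqP; rewrite -subr_eq0; apply/eqP.
have [D DE] : exists D, D = x u - y u by eexists.
rewrite -DE; have oD : orth (eigvecs x) D.
  move=> w [l l0 xw]; have [->|w0] := eqVneq w 0; first by rewrite inner0r.
  have [k Ik lk] : (lam @` I) l by rewrite lam_eig; split; [exists w|exact/eqP].
  rewrite -lk in xw l0 => {l lk}.
  (* Against an eigenvector [w] for [lam k], [x u] gives [lam k * inner u w]; in the series only the
     summand [k] survives, with the same value. *)
  rewrite DE innerBl adj (eigen_adj adj comm xw) innerZr conjcK.
  apply/eqP; rewrite subr_eq0 eq_sym; apply/eqP.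
  apply: (op_sum_inner (N := k.+1) yP) => n kn.
  rewrite inner_suml (bigD1 (Ordinal kn)) ?mem_set//= big1 ?addr0.
    rewrite innerZl; congr (_ * _); apply/esym/eqP.
    by rewrite -subr_eq0 -innerBl (projP Ik u).2.
  move=> j /andP[/set_mem Ij jk].
  rewrite innerZl (@eigen_orth _ x xs adj comm (lam j) (lam k)) ?mulr0//.
    by apply: contra_neq jk => /lam_inj jk; apply/val_inj/jk; rewrite inE.
  exact: (projP Ij u).1.
have [M hs] := rapid_hilbert_schmidt decay.
have xD : x D = 0 by exact: (orth_eigvecs_ker adj comm hs oD).
have xsD : xs D = 0 by apply: sqn_eq0; rewrite (sqn_adj adj comm) xD sqn0.
apply: sqn_eq0; rewrite /sqn {1}DE innerBl adj xsD inner0r sub0r.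
rewrite (op_sum_inner (N := 0) (c := 0) yP) ?oppr0// => n _.
rewrite inner_suml big1// => k /set_mem Ik.
rewrite innerZl inner_conj oD ?conjc0 ?mulr0//.
by exists (lam k); [exact: lam_neq0|exact: (projP Ik u).1].
Qed.

End FunctionalCalculus.

(** * Hoelder functions and powers *)

Section Main.
Variable R : realType.
Local Notation C := R[i].

(** A linear inverse of [x - l] would send 0 to the eigenvector. This makes the Hoelder bound,
    stated on the spectrum, available at every [lam k]. *)
Lemma eigenvalue_spectrum (x : {linear l2 R -> l2 R}) (l : C) :
  eigenvalues x l -> spectrum x l.
Proof.
move=> [u [u0 xu]] [y [_ [yK _]]]; move/eqP: u0; apply.
by rewrite -(yK u) /= xu subrr linear0.
Qed.

Lemma Ls's_fun_calc (x : {linear l2 R -> l2 R}) (f : C -> C) :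
  in_Ls's x -> normal_op x -> holder_at0 (spectrum x) f -> f 0 = 0 ->
  exists y : {linear l2 R -> l2 R}, is_fun_calc f x y /\ in_Ls's y.
Proof.
move=> Lx [xs [adj comm]] [theta [c [th01 c0 fh]]] f0.
have decay := Ls's_decay Lx.
have [M hs] := rapid_hilbert_schmidt decay.
have [I [lam [lam_inj lam_eig lam0]]] := eigenvalues_enum adj comm hs.
have lamI k : I k -> eigenvalues x (lam k) /\ lam k != 0.
  move=> Ik; have [] : (eigenvalues x `\ 0) (lam k) by rewrite -lam_eig; exists k.
  by move=> ? /eqP.
have /choice[P projP] k : exists Pk, I k ->
    is_orthoproj (Defs.eigenspace x (lam k)) Pk.
  have [Ik|nI] := pselect (I k); last by exists id.
  by have [Q hQ] := orthoproj_eigenspace adj comm hs (lamI k Ik).2; exists Q.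
have xsum := op_sum_eigenvalues adj comm decay lam_inj
  (fun k Ik => (lamI k Ik).2) lam0 projP lam_eig.
(* The neighbourhood in the Hoelder condition contains [lam k] for all large [k] in [I]; the earlier
   values of [f] are arbitrary. *)
have [N muN] : exists N, forall k, (N <= k)%N -> I k ->
    normc ((f \o lam) k) <= c * normc (lam k) `^ theta.
  have /nbhs_ballP[[d d'] /= dp hd] := fh.
  have /andP[/eqP d'0 d0] : (d' == 0) && (0 < d) by [].
  have [N hN] := lam0 d d0; exists N => k Nk Ik.
  have := hd (lam k); rewrite f0 subr0; apply; last first.
    exact: eigenvalue_spectrum (lamI k Ik).1.
  by rewrite /ball /= sub0r normrN normrcE d'0 ltcR hN.
have [y [Ly ysum]] := fun_calc_op_holder adj comm decay lam_inj
  (fun k Ik => (lamI k Ik).2) lam0 projP th01 c0 muN.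
by exists y; split=> //; exists I, lam, P.
Qed.

(** [theta] may exceed 1, so the exponent is [min theta 1]; on the unit ball lowering the exponent
    only increases the power. *)
Lemma holder_cpower (X : set C) (theta : R) : X `<=` [set t | 0 <= t] ->
  0 < theta -> holder_at0 X (cpower theta).
Proof.
move=> X0 th0; exists (Num.min theta 1), 1; split=> //.
  by rewrite lt_min th0 ltr01 ge_min lexx orbT.
have : nbhs (0 : C^o) (ball (0 : C^o) 1) by exact: nbhsx_ballx.
apply: filterS => t; rewrite /ball /= sub0r normrN normrcE (ltcR _ 1) => t1 /X0 /=.
rewrite lecE /= => /andP[/eqP]; case: t t1 => a b /= t1 b0 a0; move: t1.
rewrite b0 /cpower /= powR0 ?gt_eqF// !subr0 expr0n !addr0 !sqrtr_sqr mul1r.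
rewrite (ger0_norm (powR_ge0 _ _)) (ger0_norm a0) => t1.
have [->|an0] := eqVneq a 0.
  by rewrite !powR0// gt_eqF// lt_min th0 ltr01.
have ap : 0 < a by rewrite lt_neqAle eq_sym an0.
apply: ger_powR; last by rewrite ge_min lexx.
by rewrite ap ltW.
Qed.

End Main.

Unset Implicit Arguments.

Theorem corollary5p1 (R : realType) :
  (forall x : {linear l2 R -> l2 R},
     in_Ls's x -> normal_op x ->
     forall f : R[i]%C -> R[i]%C,
       holder_at0 (spectrum x) f -> f 0 = 0 ->
       exists y : {linear l2 R -> l2 R}, is_fun_calc f x y /\ in_Ls's y) /\
  (forall x : {linear l2 R -> l2 R},
     in_Ls's x -> normal_op x ->
     spectrum x `<=` [set t | 0 <= t] ->
     forall theta : R, 0 < theta ->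
       exists y : {linear l2 R -> l2 R},
         is_fun_calc (cpower theta) x y /\ in_Ls's y).
Proof.
split=> x Lx Nx; first by move=> f; exact: Ls's_fun_calc.
move=> x0 theta th0; apply: Ls's_fun_calc => //; first exact: holder_cpower.
by rewrite /cpower /= powR0// gt_eqF.
Qed.
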